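(* Let $G$ be a finite group and let $V \subset \mathbb{R}[G]_0$ be a nonzero real subrepresentation, with orthogonal isotypic decomposition $V=\bigoplus_i V_i$, where each isotypic component $V_i$ is identified, by a fixed $G$-equivariant linear isometry, with $\mathrm{Mat}_{n_i\times m_i}(D_i)$ as described in the context. Let $v \in S(V)$. Then the orbit $Gv \subset S(V)$ is a spherical 2-design in $V$ if and only if both of the following hold: (i) for each isotypic component $V_i \subset V$ there exists a matrix $M_i \in \mathrm{Mat}_{n_i \times m_i}(D_i)$ satisfying $$\overline{M_i}^{\top} M_i = \frac{1}{m_i} I_{m_i} \quad\text{and}\quad \pi_{V_i}(v) = \sqrt{\frac{\dim V_i}{\dim V}}\, M_i ;$$ (ii) the vector $v$ is the direct sum of the scaled components: $$v = \bigoplus_i \sqrt{\frac{\dim V_i}{\dim V}}\, M_i .$$ Equivalently, every spherical 2-design orbit in $V$ arises as a $G$-orbit of the form $$G\Big( \bigoplus_i \sqrt{\frac{n_i d_i}{\dim V}}\; \pi_{n_i,m_i}^{D_i}(U_i) \Big), \qquad \text{with } U_i \in \mathrm{O}_{D_i}(n_i).$$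
   Context: $\mathbb{R}[G]$ is the regular representation of the finite group $G$ with its standard $G$-invariant inner product, and $\mathbb{R}[G]_0$ is the orthogonal complement of the trivial isotypic component. For a real inner product space $V$, $S(V)$ is its unit sphere, and $\pi_{W}$ denotes orthogonal projection onto a subspace $W$. Dimensions $\dim V$, $\dim V_i$ are real dimensions. A finite set $X\subset S(V)$ is a spherical $t$-design if $\frac{1}{|X|}\sum_{x\in X} f(x)=\int_{S(V)} f\,d\mu$ for all real polynomial functions $f$ on $V$ of degree at most $t$, where $\mu$ is the normalized rotation-invariant measure on $S(V)$. For an orbit $Gv$ of a finite group acting orthogonally, being a 2-design amounts to $\sum_{g\in G} gv=0$ and $\frac{1}{|G|}\sum_{g\in G}(gv)(gv)^\top=\frac{1}{\dim V}I_V$. Matrix models. Let $W_i$ be the irreducible real representation underlying the isotypic component $V_i$, let $D_i=\mathrm{End}_G(W_i)^{\mathrm{op}}\in\{\mathbb{R},\mathbb{C},\mathbb{H}\}$ (Frobenius–Schur type) and $d_i=\dim_{\mathbb{R}}D_i$. View $W_i\cong D_i^{n_i}$ as a right $D_i$-module with a $G$-invariant $D_i$-valued Hermitian inner product and an orthonormal $D_i$-basis, so that $G$ acts by left multiplication via $\rho_i:G\to \mathrm{O}_{D_i}(n_i)$. The full $W_i$-isotypic component of $\mathbb{R}[G]$ is isomorphic to $\mathrm{Mat}_{n_i\times n_i}(D_i)$, and $V_i\cong W_i^{m_i}$ with $1\le m_i\le n_i$ is identified, via a $G$-equivariant linear isometry, with $\mathrm{Mat}_{n_i\times m_i}(D_i)$,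 on which $G$ acts by left multiplication via $\rho_i$ and which carries the real Frobenius inner product (norm $\|M\|_F^2=\sum_{k,l}|M_{kl}|^2$). Thus $\dim V_i=n_i m_i d_i$. For $D\in\{\mathbb{R},\mathbb{C},\mathbb{H}\}$, $\overline{M}$ is the entrywise conjugate, $\mathrm{O}_D(n)=\{U\in\mathrm{Mat}_{n\times n}(D):\overline{U}^\top U=I_n\}$, and $\pi_{n,m}^D:\mathrm{Mat}_{n\times n}(D)\to\mathrm{Mat}_{n\times m}(D)$ is the projection keeping the first $m$ columns. *)

(* Defs.v *)
From HB Require Import structures.
From mathcomp Require Import all_boot all_order all_algebra all_fingroup.
From mathcomp Require Import mxrepresentation.
From mathcomp Require Import finmap.
From mathcomp Require Import complex.
From mathcomp Require Import all_classical all_reals all_analysis.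
From mathcomp Require Import ring.
From mathcomp Require Import -(notations) mpoly.

Set Implicit Arguments.
Unset Strict Implicit.
Unset Printing Implicit Defensive.

Import Order.TTheory GRing.Theory Num.Theory.
Import numFieldNormedType.Exports.

Local Open Scope classical_set_scope.
Local Open Scope ring_scope.

Record quat (R : Type) := Quat { q1 : R; qi : R; qj : R; qk : R }.

Section QuaternionRing.
Variable R : comNzRingType.
Implicit Types x y z : quat R.

Definition quat_tuple x := (q1 x, qi x, qj x, qk x).
Definition tuple_quat (s : R * R * R * R) :=
  Quat s.1.1.1 s.1.1.2 s.1.2 s.2.
Lemma quat_tupleK : cancel quat_tuple tuple_quat. Proof. by case. Qed.

HB.instance Definition _ := Equality.copy (quat R) (can_type quat_tupleK).
HB.instance Definition _ := Choice.copy (quat R) (can_type quat_tupleK).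

Definition quat0 : quat R := Quat 0 0 0 0.
Definition quat_opp x := Quat (- q1 x) (- qi x) (- qj x) (- qk x).
Definition quat_add x y :=
  Quat (q1 x + q1 y) (qi x + qi y) (qj x + qj y) (qk x + qk y).

Lemma quat_addA : associative quat_add.
Proof. by move=> [? ? ? ?] [? ? ? ?] [? ? ? ?]; congr Quat; exact: addrA. Qed.
Lemma quat_addC : commutative quat_add.
Proof. by move=> [? ? ? ?] [? ? ? ?]; congr Quat; exact: addrC. Qed.
Lemma quat_add0 : left_id quat0 quat_add.
Proof. by move=> [? ? ? ?]; congr Quat; exact: add0r. Qed.
Lemma quat_addN : left_inverse quat0 quat_opp quat_add.
Proof. by move=> [? ? ? ?]; congr Quat; exact: addNr. Qed.

HB.instance Definition _ :=
  GRing.isZmodule.Build (quat R) quat_addA quat_addC quat_add0 quat_addN.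

Definition quat_one : quat R := Quat 1 0 0 0.
Definition quat_mul x y :=
  Quat (q1 x * q1 y - qi x * qi y - qj x * qj y - qk x * qk y)
       (q1 x * qi y + qi x * q1 y + qj x * qk y - qk x * qj y)
       (q1 x * qj y - qi x * qk y + qj x * q1 y + qk x * qi y)
       (q1 x * qk y + qi x * qj y - qj x * qi y + qk x * q1 y).

Lemma quat_mulA : associative quat_mul.
Proof. by move=> [? ? ? ?] [? ? ? ?] [? ? ? ?]; congr Quat => /=; ring. Qed.
Lemma quat_mul1l : left_id quat_one quat_mul.
Proof. by move=> [? ? ? ?]; congr Quat => /=; ring. Qed.
Lemma quat_mul1r : right_id quat_one quat_mul.
Proof. by move=> [? ? ? ?]; congr Quat => /=; ring. Qed.
Lemma quat_mulDl : left_distributive quat_mul +%R.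
Proof. by move=> [? ? ? ?] [? ? ? ?] [? ? ? ?]; congr Quat => /=; ring. Qed.
Lemma quat_mulDr : right_distributive quat_mul +%R.
Proof. by move=> [? ? ? ?] [? ? ? ?] [? ? ? ?]; congr Quat => /=; ring. Qed.
Lemma quat_one_neq0 : quat_one != 0.
Proof. by apply/eqP => -[/eqP]; rewrite oner_eq0. Qed.

HB.instance Definition _ := GRing.Zmodule_isNzRing.Build (quat R)
  quat_mulA quat_mul1l quat_mul1r quat_mulDl quat_mulDr quat_one_neq0.

Definition quat_conj x := Quat (q1 x) (- qi x) (- qj x) (- qk x).
Definition quat_sqnorm x := q1 x ^+ 2 + qi x ^+ 2 + qj x ^+ 2 + qk x ^+ 2.

End QuaternionRing.

Variant fs_type := FSreal | FScomplex | FSquaternion.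

Definition fs_dim (t : fs_type) : nat :=
  match t with FSreal => 1 | FScomplex => 2 | FSquaternion => 4 end.

Definition fs_alg (R : realType) (t : fs_type) : nzRingType :=
  match t with
  | FSreal => R
  | FScomplex => complex R
  | FSquaternion => quat R
  end.

Definition fs_inj (R : realType) (t : fs_type) : R -> fs_alg R t :=
  match t with
  | FSreal => fun r => r
  | FScomplex => fun r => Complex r 0
  | FSquaternion => fun r => Quat r 0 0 0
  end.

Definition fs_conj (R : realType) (t : fs_type) : fs_alg R t -> fs_alg R t :=
  match t with
  | FSreal => fun x => x
  | FScomplex => @conjc R
  | FSquaternion => @quat_conj R
  end.

Definition fs_sqnorm (R : realType) (t : fs_type) : fs_alg R t -> R :=
  match t with
  | FSreal => fun x => x ^+ 2
  | FScomplex => fun x => complex.Re x ^+ 2 + complex.Im x ^+ 2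
  | FSquaternion => @quat_sqnorm R
  end.

Section DivisionAlgebraMatrices.
Variables (R : realType) (t : fs_type).
Local Notation D := (fs_alg R t).

Definition adjmx n m (M : 'M[D]_(n, m)) : 'M[D]_(m, n) :=
  (map_mx (@fs_conj R t) M)^T.

(* The action of real scalars; [fs_inj t r] is central in D. *)
Definition real_scale n m (r : R) (M : 'M[D]_(n, m)) : 'M[D]_(n, m) :=
  fs_inj t r *: M.

Definition frob_sqnorm n m (M : 'M[D]_(n, m)) : R :=
  \sum_k \sum_l fs_sqnorm (M k l).

Definition O_D n (U : 'M[D]_n) : Prop := adjmx U *m U = 1%:M.

Definition first_cols n m (le_mn : (m <= n)%N) (U : 'M[D]_n) : 'M[D]_(n, m) :=
  colsub (widen_ord le_mn) U.

End DivisionAlgebraMatrices.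

(* Subspaces of R^n are row spaces of matrices, with the standard inner
   product. *)

Section EuclideanSubspaces.
Variables (R : realType) (n : nat).

Definition dotp (u v : 'rV[R]_n) : R := (u *m v^T) 0 0.

Definition orthocompl (U : 'M[R]_n) : 'M[R]_n := kermx U^T.

Definition oproj (U : 'M[R]_n) (u : 'rV[R]_n) : 'rV[R]_n :=
  u *m proj_mx U (orthocompl U).

Definition unit_sphere (V : 'M[R]_n) : set 'rV[R]_n :=
  [set x | (x <= V)%MS /\ dotp x x = 1].

Definition borel_rV := g_sigma_algebraType (@open 'rV[R]_n).

(* The measure lives on the Borel sets of the ambient R^n and is concentrated on
   the sphere of V.  Every linear isometry of V is the restriction to V of an orthogonal matrix
   Q preserving V. *)
Definition sphere_measure (V : 'M[R]_n) (mu : probability borel_rV R) : Prop :=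
  mu (unit_sphere V) = 1%E /\
  forall Q : 'M[R]_n, Q *m Q^T = 1%:M -> (V *m Q <= V)%MS ->
  forall A : set borel_rV, measurable A ->
    mu [set x : 'rV[R]_n | A (x *m Q)] = mu A.

Definition poly_eval (p : mpoly n R) (x : 'rV[R]_n) : R :=
  meval (fun i => x 0 i) p.

(* [msize] is one more than the total degree; a polynomial function on V is the
   restriction of one on R^n of no greater degree. *)
Definition spherical_design (V : 'M[R]_n) (mu : probability borel_rV R)
    (t : nat) (X : {fset 'rV[R]_n}) : Prop :=
  (forall x, x \in X -> unit_sphere V x) /\
  forall p : mpoly n R, (msize p <= t.+1)%N ->
    ((#|` X|%:R^-1 * \sum_(x <- X) poly_eval p x)%:E
     = \int[mu]_(x in unit_sphere V) (poly_eval p x)%:E)%E.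

End EuclideanSubspaces.

Section RegularRepresentation.
Variables (R : realType) (gT : finGroupType) (G : {group gT}).
Local Notation nG := #|G|.
Local Notation aG := (regular_repr R G).

(* [regular_repr] acts on row vectors on the right, whence the inverse. *)
Definition gact (g : gT) (u : 'rV[R]_nG) : 'rV[R]_nG := u *m aG (g^-1)%g.

Definition gorbit (u : 'rV[R]_nG) : {fset 'rV[R]_nG} :=
  [fset gact g u | g in G]%fset.

(* [rfix_mx aG G], the space of fixed vectors, is the trivial isotypic
   component. *)
Definition regular0 : 'M[R]_nG := orthocompl (rfix_mx aG G).

Definition irr_types (V : 'M[R]_nG) (I : finType) (W : I -> 'M[R]_nG) : Prop :=
  [/\ forall i, mxsimple aG (W i) /\ (W i <= V)%MS,
      forall i j, mx_iso aG (W i) (W j) -> i = j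
    & forall U, mxsimple aG U -> (U <= V)%MS -> exists i, mx_iso aG (W i) U].

(* [component_mx aG W] is the W-isotypic component of the whole of R[G]. *)
Definition isotypic_component (V W : 'M[R]_nG) : 'M[R]_nG :=
  (V :&: component_mx aG W)%MS.

(* The identification D^n ~ W need not be isometric; [mm_End] is the surjectivity
   of the canonical map D -> End_G(D^n)^op. *)
Record matrix_model (W Vi : 'M[R]_nG) := MatrixModel {
  mm_type : fs_type;
  mm_n : nat;
  mm_m : nat;
  mm_m_gt0 : (0 < mm_m)%N;
  mm_m_le_n : (mm_m <= mm_n)%N;
  mm_rho : gT -> 'M[fs_alg R mm_type]_mm_n;
  mm_rhoM : forall g h, g \in G -> h \in G ->
    mm_rho (g * h)%g = mm_rho g *m mm_rho h;
  mm_rho_O : forall g, g \in G -> O_D (mm_rho g);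
  mm_irr : 'cV[fs_alg R mm_type]_mm_n -> 'rV[R]_nG;
  mm_irr_linear : forall r x y,
    mm_irr (real_scale r x + y) = r *: mm_irr x + mm_irr y;
  mm_irr_inj : injective mm_irr;
  mm_irr_image : forall u, (u <= W)%MS <-> exists x, u = mm_irr x;
  mm_irr_equivariant : forall g x, g \in G ->
    mm_irr (mm_rho g *m x) = gact g (mm_irr x);
  mm_End : forall f : 'cV[fs_alg R mm_type]_mm_n -> 'cV[fs_alg R mm_type]_mm_n,
    (forall r x y, f (real_scale r x + y) = real_scale r (f x) + f y) ->
    (forall g x, g \in G -> f (mm_rho g *m x) = mm_rho g *m f x) ->
    exists a : fs_alg R mm_type, forall x, f x = x *m a%:M;
  mm_iso : 'M[fs_alg R mm_type]_(mm_n, mm_m) -> 'rV[R]_nG;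
  mm_iso_linear : forall r A B,
    mm_iso (real_scale r A + B) = r *: mm_iso A + mm_iso B;
  mm_iso_isometric : forall A, dotp (mm_iso A) (mm_iso A) = frob_sqnorm A;
  mm_iso_image : forall u, (u <= Vi)%MS <-> exists A, u = mm_iso A;
  mm_iso_equivariant : forall g A, g \in G ->
    mm_iso (mm_rho g *m A) = gact g (mm_iso A)
}.

Definition mm_mat (W Vi : 'M[R]_nG) (mm : matrix_model W Vi) :=
  'M[fs_alg R (mm_type mm)]_(mm_n mm, mm_m mm).

Definition mm_sqmat (W Vi : 'M[R]_nG) (mm : matrix_model W Vi) :=
  'M[fs_alg R (mm_type mm)]_(mm_n mm).

End RegularRepresentation.

(* Main.v *)
(* A G-orbit of v is a 2-design in V iff its frame operator
   T = |G|^-1 sum_g (gv)^T (gv) is (dim V)^-1 times the orthogonal projection onto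
   V: the linear moments vanish on both sides, and reflections in V force the
   second moment of the sphere to be scalar.  T commutes with G, so it preserves
   each isotypic component and acts on Mat_(n,m)(D) as right multiplication by
   some b in Mat_m(D).  If N is the i-th component of v, computing
   tr (T . R_a), where R_a is right multiplication by a, in two ways gives
   Re tr (N^* N a^* ) = n d Re tr (b^* a); hence T is the scalar c on that component
   iff N^* N = c n d 1.  Finally, over D any isometry D^m -> D^n is made of the
   first m columns of an element of O_D(n). *)

From HB Require Import structures.
Require Import Defs.
From mathcomp Require Import all_boot all_order all_algebra all_fingroup.
From mathcomp Require Import mxrepresentation finmap complex.
From mathcomp Require Import all_classical all_reals all_analysis.
From mathcomp Require Import measurable_realfun.
From mathcomp Require Import ring lra.
From mathcomp Require Import -(notations) mpoly.

(* Makes [gact] refer to [Defs] again rather than to fingroup's actions. *)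
Import Defs.

Set Implicit Arguments.
Unset Strict Implicit.
Unset Printing Implicit Defensive.

Import Order.TTheory GRing.Theory Num.Theory.
Import numFieldNormedType.Exports.
Local Open Scope classical_set_scope.
Local Open Scope ring_scope.

(** * Matrices over R, C and H *)

(** Over the quaternions the trace is not cyclic, so identities between matrices over D are tested
    against [mip A B], the real part of tr A^* B, which is cyclic and nondegenerate; R, C and H then
    share one proof. The constant n d is the weight of right multiplications: as a real space
    Mat_(n,m)(D) consists of n rows in D^m, and R_a has trace d Re tr a on each row. The trace
    identity holds for every orbit. It yields the Gram condition at once when T is scalar on the
    component; for the converse T must first be known to be some R_b, and this is where the full
    commutant, [mm_End], enters. The measure is known only through its mass on the sphere and its
    invariance. Hence the mean is killed by -1, reflections fix the second moment up to a factor,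
    and the factor is read off from the trace, the integral of |x|^2 = 1. *)

Section DivisionAlgebra.
Variables (R : realType) (t : fs_type).
Local Notation D := (fs_alg R t).
Implicit Types x y z : D.

Definition fs_re : D -> R :=
  match t return fs_alg R t -> R with
  | FSreal => fun u => u
  | FScomplex => fun u => complex.Re u
  | FSquaternion => fun u => q1 u
  end.

Definition fs_basis : 'I_(fs_dim t) -> D :=
  match t return 'I_(fs_dim t) -> fs_alg R t with
  | FSreal => fun=> 1
  | FScomplex => fun s => if s == 0 :> nat then Complex 1 0 else Complex 0 1
  | FSquaternion => fun s =>
      Quat (s == 0 :> nat)%:R (s == 1 :> nat)%:R
           (s == 2 :> nat)%:R (s == 3 :> nat)%:R
  end.

Local Notation conj := (@fs_conj R t).

Lemma fs_reB : {morph fs_re : x y / x - y}.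
Proof. by rewrite /fs_re; case: t => //= -[? ?] [? ?]. Qed.

HB.instance Definition _ :=
  GRing.isZmodMorphism.Build (fs_alg R t) R fs_re fs_reB.

Lemma fs_conjB : {morph conj : x y / x - y}.
Proof.
rewrite /fs_conj; case: t => //= -[a b] => [[c d]|c d [e f g h]].
  by congr Complex; rewrite opprD.
by congr Quat; rewrite /= opprD.
Qed.

HB.instance Definition _ :=
  GRing.isZmodMorphism.Build (fs_alg R t) (fs_alg R t) conj fs_conjB.

Lemma fs_injB : {morph @fs_inj R t : r s / r - s >-> r - s}.
Proof.
rewrite /fs_inj; case: t => //= r s.
  by congr Complex; rewrite subrr.
by congr Quat; rewrite /= subrr.
Qed.

HB.instance Definition _ :=
  GRing.isZmodMorphism.Build R (fs_alg R t) (@fs_inj R t) fs_injB.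

Lemma fs_inj1 : fs_inj t 1 = 1 :> D.
Proof. by case: t. Qed.

Lemma fs_injM r s : fs_inj t (r * s) = fs_inj t r * fs_inj t s :> D.
Proof.
case: t => //=; first by congr Complex; ring.
by congr Quat => /=; ring.
Qed.

Lemma fs_injC r x : fs_inj t r * x = x * fs_inj t r.
Proof.
case: t x => /= [x|[a b]|[a b c d]]; first exact: mulrC.
  by congr Complex; ring.
by congr Quat => /=; ring.
Qed.

Lemma fs_conj_inj r : conj (fs_inj t r) = fs_inj t r.
Proof.
case: t => //=; first by congr Complex; rewrite oppr0.
by rewrite /quat_conj /= oppr0.
Qed.

Lemma fs_conj1 : conj 1 = 1.
Proof. by rewrite -fs_inj1 fs_conj_inj. Qed.

Lemma fs_conjK : involutive conj.
Proof.
by case: t => //= [[a b]|[a b c d]]; rewrite /= /quat_conj /= !opprK.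
Qed.

Lemma fs_conjM x y : conj (x * y) = conj y * conj x.
Proof.
case: t x y => /= [x y|[a b] [c d]|[a b c d] [e f g h]]; first exact: mulrC.
  by congr Complex; ring.
by congr Quat => /=; ring.
Qed.

Lemma fs_re_inj r : fs_re (fs_inj t r) = r.
Proof. by rewrite /fs_re; case: t. Qed.

Lemma fs_reZ r x : fs_re (fs_inj t r * x) = r * fs_re x.
Proof. by rewrite /fs_re; case: t x => //= [[a b]|[a b c d]] /=; ring. Qed.

Lemma fs_re_conj x : fs_re (conj x) = fs_re x.
Proof. by rewrite /fs_re; case: t x => //= -[]. Qed.

(** Commutators in D are purely imaginary, even over the quaternions; hence [re_tr] is cyclic
    although the trace is not. *)
Lemma fs_reMC x y : fs_re (x * y) = fs_re (y * x).
Proof.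
by rewrite /fs_re; case: t x y => /= [x y|[a b] [c d]|[a b c d] [e f g h]] /=;
  ring.
Qed.

Lemma fs_sqnormE x : fs_sqnorm x = fs_re (conj x * x).
Proof.
by rewrite /fs_re; case: t x => /= [x|[a b]|[a b c d]];
  rewrite /= /quat_sqnorm /=; ring.
Qed.

Lemma fs_mul_conj x : conj x * x = fs_inj t (fs_sqnorm x).
Proof.
case: t x => /= [x|[a b]|[a b c d]] //.
  by congr Complex => /=; ring.
by congr Quat; rewrite /quat_sqnorm /=; ring.
Qed.

Lemma fs_sqnorm_ge0 x : 0 <= fs_sqnorm x.
Proof.
by case: t x => /= [x|[a b]|[a b c d]]; rewrite /quat_sqnorm /=;
  rewrite ?addr_ge0 ?sqr_ge0.
Qed.

Lemma fs_sqnorm_eq0 x : fs_sqnorm x = 0 -> x = 0.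
Proof.
case: t x => /= [x /eqP|[a b] /= /eqP|[a b c d]].
- by rewrite sqrf_eq0 => /eqP.
- by rewrite paddr_eq0 ?sqr_ge0 // !sqrf_eq0 => /andP[/eqP -> /eqP ->].
rewrite /quat_sqnorm /= => /eqP; rewrite !paddr_eq0 ?addr_ge0 ?sqr_ge0 //.
by rewrite !sqrf_eq0 => /andP[/andP[/andP[/eqP-> /eqP->] /eqP->] /eqP->].
Qed.

Lemma fs_basis_norm s : conj (fs_basis s) * fs_basis s = 1.
Proof.
rewrite fs_mul_conj -fs_inj1; congr fs_inj; rewrite /fs_basis.
case: t s => /= [s|s|s]; first by rewrite expr1n.
  by case: ifP => _ /=; rewrite ?expr1n ?expr0n /= ?addr0 ?add0r.
by case: s => -[|[|[|[|]]]] //= _; rewrite /quat_sqnorm /=;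
  rewrite !expr1n !expr0n /= ?addr0 ?add0r.
Qed.

Lemma fs_parseval x y :
  \sum_s fs_re (conj (fs_basis s) * x) * fs_re (conj (fs_basis s) * y)
    = fs_re (conj x * y).
Proof.
rewrite /fs_re /fs_basis.
by case: t x y => /= [x y|[a b] [c d]|[a b c d] [e f g h]];
  rewrite !big_ord_recl big_ord0 /=; ring.
Qed.

Lemma fs_basis_orth s s' :
  fs_re (conj (fs_basis s) * fs_basis s') = (s == s')%:R.
Proof.
rewrite /fs_re /fs_basis -val_eqE.
case: t s s' => /= [s s'|s s'|s s']; first by rewrite !ord1 mulr1.
  by case: s s' => -[|[|]] //= _ [[|[|]]] //= _; ring.
by case: s s' => -[|[|[|[|]]]] //= _ [[|[|[|[|]]]]] //= _; ring.
Qed.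

End DivisionAlgebra.

(** * The real inner product on Mat_(n,m)(D) *)

Section MatrixInnerProduct.
Variables (R : realType) (t : fs_type).
Local Notation D := (fs_alg R t).

Lemma adjmxK n m : cancel (@adjmx R t n m) (@adjmx R t m n).
Proof. by move=> M; apply/matrixP => i j; rewrite !mxE fs_conjK. Qed.

Lemma adjmxM n m p (A : 'M[D]_(n, m)) (B : 'M[D]_(m, p)) :
  adjmx (A *m B) = adjmx B *m adjmx A.
Proof.
apply/matrixP => i j; rewrite !mxE raddf_sum /=; apply: eq_bigr => k _.
by rewrite fs_conjM !mxE.
Qed.

Lemma adjmx1 n : adjmx (1%:M : 'M[D]_n) = 1%:M.
Proof.
by apply/matrixP => i j; rewrite !mxE eq_sym; case: eqP => _;
  rewrite ?mulr1n ?mulr0n ?fs_conj1 ?raddf0.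
Qed.

Lemma adjmx_scale n m r (A : 'M[D]_(n, m)) :
  adjmx (real_scale r A) = real_scale r (adjmx A).
Proof.
by apply/matrixP => i j; rewrite !mxE fs_conjM fs_conj_inj fs_injC.
Qed.

Lemma real_scaleA n m r s (A : 'M[D]_(n, m)) :
  real_scale r (real_scale s A) = real_scale (r * s) A.
Proof. by rewrite /real_scale scalerA fs_injM. Qed.

Lemma real_scale1 n m (A : 'M[D]_(n, m)) : real_scale 1 A = A.
Proof. by rewrite /real_scale fs_inj1 scale1r. Qed.

Lemma real_scale_mulr n m p r (A : 'M[D]_(n, m)) (B : 'M[D]_(m, p)) :
  A *m real_scale r B = real_scale r (A *m B).
Proof.
apply/matrixP => i j; rewrite !mxE mulr_sumr; apply: eq_bigr => k _.
by rewrite !mxE mulrA -fs_injC mulrA.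
Qed.

Lemma real_scale_mull n m p r (A : 'M[D]_(n, m)) (B : 'M[D]_(m, p)) :
  real_scale r A *m B = real_scale r (A *m B).
Proof. by rewrite /real_scale scalemxAl. Qed.

Definition re_tr n (A : 'M[D]_n) : R := fs_re (\tr A).

Lemma re_tr_mulC n m (A : 'M[D]_(n, m)) (B : 'M[D]_(m, n)) :
  re_tr (A *m B) = re_tr (B *m A).
Proof.
rewrite /re_tr /mxtrace !raddf_sum /=.
under eq_bigr do rewrite mxE raddf_sum /=.
under [RHS]eq_bigr do rewrite mxE raddf_sum /=.
rewrite exchange_big /=; apply: eq_bigr => i _; apply: eq_bigr => j _.
exact: fs_reMC.
Qed.

Lemma re_tr_adj n (A : 'M[D]_n) : re_tr (adjmx A) = re_tr A.
Proof.
rewrite /re_tr /mxtrace !raddf_sum /=; apply: eq_bigr => i _.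
by rewrite !mxE fs_re_conj.
Qed.

Lemma re_tr_scale n r (A : 'M[D]_n) : re_tr (real_scale r A) = r * re_tr A.
Proof.
rewrite /re_tr /mxtrace !raddf_sum /= mulr_sumr; apply: eq_bigr => i _.
by rewrite !mxE fs_reZ.
Qed.

Lemma re_tr1 n : re_tr (1%:M : 'M[D]_n) = n%:R.
Proof.
rewrite /re_tr /mxtrace raddf_sum /= -[n in RHS]card_ord -sum1_card natr_sum.
by apply: eq_bigr => i _; rewrite mxE eqxx -fs_inj1 fs_re_inj.
Qed.

(** Polarization of the squared Frobenius norm. It is real-valued for every D, so an isometric
    real-linear map preserves it. *)
Definition mip n m (A B : 'M[D]_(n, m)) : R := re_tr (adjmx A *m B).

Lemma mipE n m (A B : 'M[D]_(n, m)) :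
  mip A B = \sum_k \sum_l fs_re (fs_conj (A k l) * B k l).
Proof.
rewrite /mip /re_tr /mxtrace raddf_sum exchange_big; apply: eq_bigr => i _ /=.
by rewrite mxE raddf_sum; apply: eq_bigr => j _; rewrite !mxE.
Qed.

Lemma frob_mip n m (A : 'M[D]_(n, m)) : frob_sqnorm A = mip A A.
Proof.
rewrite mipE; apply: eq_bigr => k _; apply: eq_bigr => l _.
exact: fs_sqnormE.
Qed.

Lemma mipC n m (A B : 'M[D]_(n, m)) : mip A B = mip B A.
Proof. by rewrite /mip -re_tr_adj adjmxM adjmxK. Qed.

Lemma mipDr n m (A B C : 'M[D]_(n, m)) : mip A (B + C) = mip A B + mip A C.
Proof. by rewrite /mip /re_tr mulmxDr !raddfD. Qed.

Lemma mipBr n m (A B C : 'M[D]_(n, m)) : mip A (B - C) = mip A B - mip A C.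
Proof. by rewrite /mip /re_tr mulmxBr !raddfB. Qed.

Lemma mip_mulr n m (A B : 'M[D]_(n, m)) (c : 'M[D]_m) :
  mip A (B *m c) = mip (A *m adjmx c) B.
Proof. by rewrite /mip adjmxM adjmxK mulmxA re_tr_mulC mulmxA. Qed.

Lemma mip_eq0 n m (A : 'M[D]_(n, m)) : mip A A = 0 -> A = 0.
Proof.
rewrite -frob_mip /frob_sqnorm => /eqP; rewrite psumr_eq0; last first.
  by move=> k _; apply: sumr_ge0 => l _; apply: fs_sqnorm_ge0.
move=> /allP A0; apply/matrixP => k l; rewrite mxE.
have := A0 k (mem_index_enum _); rewrite /= psumr_eq0; last first.
  by move=> j _; apply: fs_sqnorm_ge0.
by move=> /allP/(_ l (mem_index_enum _))/= /eqP; apply: fs_sqnorm_eq0.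
Qed.

Lemma mip_inj n m (A B : 'M[D]_(n, m)) :
  (forall C, mip C A = mip C B) -> A = B.
Proof.
by move=> AB; apply/subr0_eq/mip_eq0; rewrite mipBr AB subrr.
Qed.

Definition mx_index n m : finType := ('I_n * 'I_m * 'I_(fs_dim t))%type.

Definition mx_basis n m (x : mx_index n m) : 'M[D]_(n, m) :=
  fs_basis R x.2 *: delta_mx x.1.1 x.1.2.

Lemma card_mx_index n m : #|mx_index n m| = (n * m * fs_dim t)%N.
Proof. by rewrite !card_prod !card_ord. Qed.

Lemma mip_basis n m x (A : 'M[D]_(n, m)) :
  mip (mx_basis x) A = fs_re (fs_conj (fs_basis R x.2) * A x.1.1 x.1.2).
Proof.
case: x => [[k l] s]; rewrite mipE (bigD1 k) //= (bigD1 l) //=.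
rewrite !mxE !eqxx mulr1 big1 ?addr0 => [|j jl]; last first.
  by rewrite !mxE (negPf jl) andbF mulr0 raddf0 mul0r raddf0.
rewrite big1 ?addr0 // => i ik; rewrite big1 // => j _.
by rewrite !mxE (negPf ik) mulr0 raddf0 mul0r raddf0.
Qed.

Lemma mip_basis_orth n m (x y : mx_index n m) :
  mip (mx_basis x) (mx_basis y) = (x == y)%:R.
Proof.
rewrite mip_basis; case: x y => [[k l] s] [[k' l'] s'] /=.
rewrite !mxE !xpair_eqE.
case: (k == k') => /=; last by rewrite mulr0 mulr0 raddf0.
case: (l == l') => /=; last by rewrite mulr0 mulr0 raddf0.
by rewrite mulr1 fs_basis_orth.
Qed.

Lemma mx_parseval n m (A B : 'M[D]_(n, m)) :
  \sum_x mip (mx_basis x) A * mip (mx_basis x) B = mip A B.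
Proof.
under eq_bigr do rewrite !mip_basis.
rewrite mipE pair_bigA -(pair_bigA _ (fun p s =>
  fs_re (fs_conj (fs_basis R s) * A p.1 p.2)
  * fs_re (fs_conj (fs_basis R s) * B p.1 p.2))) /=.
by apply: eq_bigr => p _; exact: fs_parseval.
Qed.

(** For x = (k, l, s) the unit of index s has norm one, so e_x^* e_x is the elementary matrix at (l,
    l). Each l occurs for n rows k and d units s, and these elementary matrices sum to 1: this is
    the source of the factor n d. *)
Lemma mip_basis_mul n m (a b : 'M[D]_m) :
  \sum_(x : mx_index n m) mip (mx_basis x *m a) (mx_basis x *m b)
    = (n * fs_dim t)%:R * re_tr (adjmx a *m b).
Proof.
have E (x : mx_index n m) : mip (mx_basis x *m a) (mx_basis x *m b)
    = re_tr (adjmx a *m delta_mx x.1.2 x.1.2 *m b).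
  case: x => [[k l] s]; rewrite /mip adjmxM /mx_basis /= -!mulmxA.
  congr (re_tr (_ *m _)); rewrite mulmxA; congr (_ *m _).
  apply/matrixP => i j; rewrite !mxE (bigD1 k) //= big1 ?addr0 => [|h hk].
    rewrite !mxE eqxx /=; case: (i == l); case: (j == l) => /=;
      by rewrite ?mulr1 ?mulr0 ?raddf0 ?mul0r ?fs_basis_norm.
  by rewrite !mxE (negPf hk) /= !mulr0.
under eq_bigr do rewrite E.
rewrite -(pair_bigA _ (fun p s =>
  re_tr (adjmx a *m delta_mx p.2 p.2 *m b))) /=.
under eq_bigr do rewrite sumr_const card_ord.
rewrite -(pair_bigA _ (fun k l =>
  re_tr (adjmx a *m delta_mx l l *m b) *+ fs_dim t)) /=.
rewrite sumr_const card_ord sumrMnl -mulrnA mulnC -[LHS]mulr_natl.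
congr (_ * _); rewrite /re_tr -!raddf_sum -mulmx_suml -mulmx_sumr.
by rewrite -mx1_sum_delta mulmx1.
Qed.

End MatrixInnerProduct.

(** * Completing isometries D^m -> D^n to elements of O_D(n) *)

Section IsometryExtension.
Variables (R : realType) (t : fs_type).
Local Notation D := (fs_alg R t).

Lemma mip_ge0 n m (A : 'M[D]_(n, m)) : 0 <= mip A A.
Proof.
rewrite -frob_mip; apply: sumr_ge0 => k _; apply: sumr_ge0 => l _.
exact: fs_sqnorm_ge0.
Qed.

Lemma adjmx_mul_col n (x : 'cV[D]_n) :
  adjmx x *m x = real_scale (mip x x) 1%:M.
Proof.
apply/matrixP => i j; rewrite !ord1 !mxE eqxx mulr1 -frob_mip raddf_sum.
by apply: eq_bigr => k _; rewrite big_ord1 !mxE fs_mul_conj.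
Qed.

(* The nonzero columns of [1 - M M^*] are orthogonal to those of [M]; they cannot
   all vanish since [tr (M M^* ) = tr (M^* M) = m]. *)
Lemma isometry_orth_col n m (M : 'M[D]_(n, m)) : (m < n)%N ->
  adjmx M *m M = 1%:M ->
  exists2 x : 'cV[D]_n, adjmx M *m x = 0 & adjmx x *m x = 1%:M.
Proof.
move=> ltmn M1; pose Q := 1%:M - M *m adjmx M.
have MQ : adjmx M *m Q = 0 by rewrite mulmxBr mulmx1 mulmxA M1 mul1mx subrr.
have [k xk] : exists k, Q *m (delta_mx k 0 : 'cV[D]_n) != 0.
  apply/existsP; apply: contraLR ltmn; rewrite negb_exists => /forallP Q0.
  have {Q0} /subr0_eq/(congr1 (@re_tr R t n)) : Q = 0.
    rewrite -[Q]mulmx1 mx1_sum_delta mulmx_sumr big1 // => k _.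
    have /negbNE/eqP Qk := Q0 k.
    by rewrite -(mul_delta_mx (0 : 'I_1)) mulmxA Qk mul0mx.
  by rewrite re_tr_mulC M1 !re_tr1 => /eqP; rewrite eqr_nat => /eqP ->;
    rewrite ltnn.
set x := _ *m _ in xk.
have x_gt0 : 0 < mip x x.
  rewrite lt_neqAle mip_ge0 andbT eq_sym.
  by apply: contra xk => /eqP/mip_eq0 ->.
exists (real_scale (Num.sqrt (mip x x))^-1 x).
  by rewrite real_scale_mulr mulmxA MQ mul0mx /real_scale scaler0.
rewrite adjmx_scale real_scale_mull real_scale_mulr adjmx_mul_col.
rewrite !real_scaleA -expr2 exprVn sqr_sqrtr ?ltW // mulVf ?gt_eqF //.
by rewrite real_scale1.
Qed.

Lemma adjmx_row n m p (A : 'M[D]_(n, m)) (B : 'M[D]_(n, p)) :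
  adjmx (row_mx A B) = col_mx (adjmx A) (adjmx B).
Proof. by rewrite /adjmx map_row_mx tr_row_mx. Qed.

Lemma adjmx_first_cols n m (le_mn : (m <= n)%N) (U : 'M[D]_n) : O_D U ->
  adjmx (first_cols le_mn U) *m first_cols le_mn U = 1%:M.
Proof.
move=> U1; apply/matrixP => i j.
have /matrixP/(_ (widen_ord le_mn i) (widen_ord le_mn j)) := U1.
rewrite !mxE.
have -> : (widen_ord le_mn i == widen_ord le_mn j) = (i == j).
  by rewrite -!val_eqE.
by move=> <-; apply: eq_bigr => k _; rewrite !mxE.
Qed.

(** Induction on n - m: a unit column orthogonal to those of [M] is appended until the matrix is
    square, and a square isometry is already in O_D(n). *)
Lemma isometry_extend n m (le_mn : (m <= n)%N) (M : 'M[D]_(n, m)) :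
  adjmx M *m M = 1%:M -> exists2 U : 'M[D]_n, O_D U & first_cols le_mn U = M.
Proof.
elim: {m}(n - m)%N {-2}m (erefl (n - m)%N) le_mn M => [|k IH] m Em le_mn M M1.
  have Emn : m = n by apply/eqP; rewrite eqn_leq le_mn -subn_eq0 Em.
  subst m; exists M => //; apply/matrixP => i j; rewrite !mxE.
  by congr (M _ _); apply: val_inj.
have ltmn : (m < n)%N by rewrite -subn_gt0 Em.
have [x Mx x1] := isometry_orth_col ltmn M1.
have le' : (m + 1 <= n)%N by rewrite addn1.
have [] := IH (m + 1)%N _ le' (row_mx M x).
- by rewrite addn1 subnS Em.
- rewrite adjmx_row mul_col_row M1 Mx x1 scalar_mx_block.
  (* The lower left block x^* M is the adjoint of M^* x = 0. *)
  by rewrite -[adjmx x *m M]adjmxK adjmxM adjmxK Mx /adjmx map_mx0 !trmx0.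
move=> U U1 UM; exists U => //; apply/matrixP => i j.
rewrite -[RHS](row_mxEl M x) -UM !mxE; congr (U _ _); exact: val_inj.
Qed.

End IsometryExtension.

(** * Moments of the sphere measure *)

Section OrthogonalProjection.
Variables (R : realType) (n : nat).
Implicit Types U V : 'M[R]_n.

Lemma dotpE (u v : 'rV[R]_n) : dotp u v = \sum_i u 0 i * v 0 i.
Proof. by rewrite /dotp mxE; apply: eq_bigr => i _; rewrite mxE. Qed.

Lemma dotpC (u v : 'rV[R]_n) : dotp u v = dotp v u.
Proof. by rewrite !dotpE; apply: eq_bigr => i _; rewrite mulrC. Qed.

Lemma dotpDl (u v w : 'rV[R]_n) : dotp (u + v) w = dotp u w + dotp v w.
Proof. by rewrite /dotp mulmxDl mxE. Qed.

Lemma dotpDr (u v w : 'rV[R]_n) : dotp w (u + v) = dotp w u + dotp w v.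
Proof. by rewrite !(dotpC w) dotpDl. Qed.

Lemma dotpZl r (u v : 'rV[R]_n) : dotp (r *: u) v = r * dotp u v.
Proof. by rewrite /dotp -scalemxAl mxE. Qed.

Lemma dotpZr r (u v : 'rV[R]_n) : dotp u (r *: v) = r * dotp u v.
Proof. by rewrite dotpC dotpZl dotpC. Qed.

Lemma dotpNl (u v : 'rV[R]_n) : dotp (- u) v = - dotp u v.
Proof. by rewrite -scaleN1r dotpZl mulN1r. Qed.

Lemma dotpNr (u v : 'rV[R]_n) : dotp u (- v) = - dotp u v.
Proof. by rewrite dotpC dotpNl dotpC. Qed.

Lemma dotpBr (u v w : 'rV[R]_n) : dotp w (u - v) = dotp w u - dotp w v.
Proof. by rewrite dotpDr dotpNr. Qed.

Lemma dotp0l (u : 'rV[R]_n) : dotp 0 u = 0.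
Proof. by rewrite /dotp mul0mx mxE. Qed.

Lemma dotp0r (u : 'rV[R]_n) : dotp u 0 = 0.
Proof. by rewrite dotpC dotp0l. Qed.

Lemma dotp_sumr (J : finType) (P : pred J) (u : 'rV[R]_n) F :
  dotp u (\sum_(i | P i) F i) = \sum_(i | P i) dotp u (F i).
Proof. by rewrite /dotp linear_sum mulmx_sumr summxE. Qed.

Lemma dotp_ge0 (u : 'rV[R]_n) : 0 <= dotp u u.
Proof. by rewrite dotpE sumr_ge0 // => i _; rewrite -expr2 sqr_ge0. Qed.

Lemma dotp_eq0 (u : 'rV[R]_n) : (dotp u u == 0) = (u == 0).
Proof.
apply/eqP/eqP => [|->]; last exact: dotp0l.
rewrite dotpE => /eqP; rewrite psumr_eq0 => [/allP u0|i _]; last first.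
  by rewrite -expr2 sqr_ge0.
apply/rowP => i; rewrite mxE.
by have /= := u0 i (mem_index_enum _); rewrite mulf_eq0 orbb => /eqP.
Qed.

Lemma dotp_mulmx (u v : 'rV[R]_n) (A : 'M[R]_n) :
  dotp (u *m A) v = dotp u (v *m A^T).
Proof. by rewrite /dotp trmx_mul trmxK mulmxA. Qed.

Lemma dotp_mx_inj (A B : 'M[R]_n) :
  (forall u w : 'rV[R]_n, dotp (u *m A) w = dotp (u *m B) w) -> A = B.
Proof.
move=> AB; apply/matrixP => i j; have := AB (delta_mx 0 i) (delta_mx 0 j).
by rewrite /dotp !trmx_delta -!rowE -!colE !mxE.
Qed.

Lemma sub_orthocompl m (A : 'M[R]_(m, n)) U :
  (A <= orthocompl U)%MS = (A *m U^T == 0).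
Proof. by rewrite /orthocompl sub_kermx. Qed.

Lemma orthocomplP (u : 'rV[R]_n) U :
  reflect (forall w : 'rV[R]_n, (w <= U)%MS -> dotp u w = 0)
          (u <= orthocompl U)%MS.
Proof.
rewrite sub_orthocompl; apply: (iffP eqP) => [uU w /submxP[z ->]|uU].
  by rewrite /dotp trmx_mul mulmxA uU mul0mx mxE.
apply/matrixP => i j; rewrite ord1 [RHS]mxE -(uU (row j U)) ?row_sub //.
by rewrite /dotp !mxE; apply: eq_bigr => k _; rewrite !mxE.
Qed.

Lemma capmx_orthocompl U : (U :&: orthocompl U = 0)%MS.
Proof.
apply/eqP/rowV0P => u; rewrite sub_capmx => /andP[uU /orthocomplP/(_ _ uU)].
by move/eqP; rewrite dotp_eq0 => /eqP.
Qed.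

Lemma addsmx_orthocompl m (A : 'M[R]_(m, n)) U :
  (A <= U + orthocompl U)%MS.
Proof.
apply: submx_full; rewrite /row_full; apply/eqP.
rewrite (mxdirectP _) /=; last by apply/mxdirect_addsP/capmx_orthocompl.
by rewrite /orthocompl mxrank_ker mxrank_tr subnKC // rank_leq_row.
Qed.

Definition oprojmx U : 'M[R]_n := proj_mx U (orthocompl U).

Lemma oprojE U u : oproj U u = u *m oprojmx U. Proof. by []. Qed.

Lemma oprojmx_id m (A : 'M[R]_(m, n)) U : (A <= U)%MS -> A *m oprojmx U = A.
Proof. exact/proj_mx_id/capmx_orthocompl. Qed.

Lemma oprojmx_0 m (A : 'M[R]_(m, n)) U :
  (A <= orthocompl U)%MS -> A *m oprojmx U = 0.
Proof. exact/proj_mx_0/capmx_orthocompl. Qed.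

Lemma oprojmx_sub m (A : 'M[R]_(m, n)) U : (A *m oprojmx U <= U)%MS.
Proof. exact: proj_mx_sub. Qed.

Lemma oprojmx_compl_sub m (A : 'M[R]_(m, n)) U :
  (A - A *m oprojmx U <= orthocompl U)%MS.
Proof. exact/proj_mx_compl_sub/addsmx_orthocompl. Qed.

Lemma oprojmx_idem U : oprojmx U *m oprojmx U = oprojmx U.
Proof. by apply: oprojmx_id; rewrite -[X in (X <= _)%MS]mul1mx oprojmx_sub. Qed.

(** The rows of P lie in U and those of 1 - P in its complement, so P (1 - P)^T = 0. Thus P = P P^T,
    which is symmetric. *)
Lemma oprojmx_sym U : (oprojmx U)^T = oprojmx U.
Proof.
have PU : (oprojmx U <= U)%MS by rewrite -[oprojmx U]mul1mx oprojmx_sub.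
have : oprojmx U *m (1%:M - oprojmx U)^T = 0.
  have := oprojmx_compl_sub 1%:M U; rewrite mul1mx sub_orthocompl => /eqP QU.
  have /submxP[Z {1}->] := PU.
  by rewrite -mulmxA -[U *m _]trmxK trmx_mul trmxK QU trmx0 mulmx0.
rewrite linearB /= trmx1 mulmxBr mulmx1 => /subr0_eq P2.
by rewrite P2 trmx_mul trmxK.
Qed.

(** A full-rank factorization P = C B turns P P = P into B C = 1, an identity matrix whose size is
    the rank, and the trace is cyclic. *)
Lemma mxtrace_idem (P : 'M[R]_n) : P *m P = P -> \tr P = (\rank P)%:R.
Proof.
move=> PP; have := (row_base_free P, col_base_full P, mulmx_base P).
move: (\rank P) (col_base P) (row_base P) => r C B [[Bfree Cfull] CB].
suff BC : B *m C = 1%:M by rewrite -CB mxtrace_mulC BC mxtrace1.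
apply: (row_free_inj Bfree) => /=; apply: (row_full_inj Cfull) => /=.
by rewrite mul1mx CB -!mulmxA CB mulmxA CB PP.
Qed.

Lemma mxtrace_oprojmx U : \tr (oprojmx U) = (\rank U)%:R.
Proof.
rewrite mxtrace_idem ?oprojmx_idem //; congr _%:R.
apply/eqP; rewrite eqn_leq !mxrankS //; last first.
  by rewrite -[oprojmx U]mul1mx oprojmx_sub.
by rewrite -{1}(oprojmx_id (submx_refl U)) submxMl.
Qed.

End OrthogonalProjection.

(** * Borel measurability of linear forms and of the sphere *)

Section BorelMeasurability.
Variables (R : realType) (n : nat).
Local Notation T := (borel_rV R n).

Lemma measurable_coord i : measurable_fun setT (fun x : T => x 0 i : R).
Proof.
apply: (measurability _ (RGenOpens.measurableE R)).
move=> _ [_ [a [b ->] <-]]; rewrite setTI; apply: sub_sigma_algebra.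
have /continuousP := @coord_continuous R 1 n 0 i.
by apply; exact: interval_open.
Qed.

Lemma measurable_dotp (u : 'rV[R]_n) :
  measurable_fun setT (fun x : T => dotp x u).
Proof.
under eq_fun do rewrite dotpE.
apply: measurable_sum => i.
by apply: measurable_funM => //; exact: measurable_coord.
Qed.

Definition quadr (A : 'M[R]_n) (x : 'rV[R]_n) : R := (x *m A *m x^T) 0 0.

Lemma quadrE A x : quadr A x = \sum_i \sum_j A i j * (x 0 i * x 0 j).
Proof.
rewrite /quadr mxE exchange_big; apply: eq_bigr => j _.
rewrite !mxE mulr_suml; apply: eq_bigr => i _.
by rewrite mulrAC mulrC.
Qed.

Lemma measurable_unit_sphere (V : 'M[R]_n) :
  measurable (unit_sphere V : set T).
Proof.
(* The first sum of squares encodes the linear equations of V, the last square the equation |x|^2 =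
   1: the sphere is the zero set of one measurable function. *)
pose f (x : T) : R := \sum_j dotp x (row j (cokermx V)^T) ^+ 2
                      + (\sum_i x 0 i * x 0 i - 1) ^+ 2.
have mf : measurable_fun setT f.
  apply: measurable_funD.
    apply: measurable_sum => j; apply: measurable_funX; exact: measurable_dotp.
  apply: measurable_funX; apply: measurable_funB => //.
  by apply: measurable_sum => i; apply: measurable_funM; exact: measurable_coord.
suff -> : (unit_sphere V : set T) = setT `&` f @^-1` [set 0].
  exact: mf.
rewrite setTI; apply/seteqP; split=> x.
  case; rewrite submxE => /eqP xV x1; rewrite /f /= -dotpE x1 subrr.
  rewrite expr0n addr0 big1 // => j _.
  suff -> : dotp x (row j (cokermx V)^T) = (x *m cokermx V) 0 j.
    by rewrite xV mxE expr0n.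
  by rewrite dotpE mxE; apply: eq_bigr => k _; rewrite !mxE.
rewrite /f /= -dotpE => /eqP; rewrite paddr_eq0 ?sqr_ge0 //; last first.
  by apply: sumr_ge0 => j _; exact: sqr_ge0.
rewrite sqrf_eq0 subr_eq0 => /andP[xV /eqP x1]; split => //.
move: xV; rewrite psumr_eq0 => [/allP x0|j _]; last exact: sqr_ge0.
rewrite submxE; apply/eqP/rowP => j; rewrite [RHS]mxE.
have /= := x0 j (mem_index_enum _); rewrite sqrf_eq0 => /eqP <-.
by rewrite dotpE mxE; apply: eq_bigr => k _; rewrite !mxE.
Qed.

End BorelMeasurability.

(** * Integrals of polynomials of degree at most two over the sphere *)

Section SphereMoments.
Variables (R : realType) (n : nat) (V : 'M[R]_n).
Variable mu : probability (borel_rV R n) R.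
Hypothesis mu_sphere : sphere_measure V mu.
Local Notation T := (borel_rV R n).
Local Notation S := (unit_sphere V : set T).
Local Open Scope ereal_scope.

Let mS : measurable S. Proof. exact: measurable_unit_sphere. Qed.

Let muS : mu S = 1. Proof. by case: mu_sphere. Qed.

Lemma sphere_coord_le1 x i : S x -> (`|x 0%R i| <= 1)%R.
Proof.
case=> _; rewrite dotpE => x1; rewrite -[leRHS](normr1 R) -ler_sqr ?nnegrE //.
rewrite !real_normK ?num_real // expr1n -x1 (bigD1 i) //= -expr2 lerDl.
by apply: sumr_ge0 => j _; rewrite -expr2 sqr_ge0.
Qed.

Lemma sphere_integrable f (M : R) : measurable_fun setT (f : T -> R) ->
  (forall x, S x -> (`|f x| <= M)%R) -> mu.-integrable S (EFin \o f).
Proof.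
move=> mf fM; apply: measurable_bounded_integrable => //.
- by have := muS; rewrite /= => ->; rewrite ltry.
- exact: measurable_funTS.
exists M; split => [|r Mr x Sx]; first exact: num_real.
exact: le_trans (fM _ Sx) (ltW Mr).
Qed.

Lemma sphere_integrable_coord i :
  mu.-integrable S (EFin \o (fun x : T => x 0%R i)).
Proof.
by apply: (@sphere_integrable _ 1) => [|x /sphere_coord_le1 //];
  exact: measurable_coord.
Qed.

Lemma sphere_integrable_coord2 i j :
  mu.-integrable S (EFin \o (fun x : T => x 0 i * x 0 j)%R).
Proof.
apply: (@sphere_integrable _ 1) => [|x Sx].
  by apply: measurable_funM; exact: measurable_coord.
by rewrite normrM mulr_ile1 ?sphere_coord_le1.
Qed.

Lemma integrable_lincomb (J : finType) (c : J -> R) (f : J -> T -> R) :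
  (forall j, mu.-integrable S (EFin \o f j)) ->
  mu.-integrable S (EFin \o (fun x => \sum_j c j * f j x)%R).
Proof.
move=> intf.
have -> : EFin \o (fun x => \sum_j c j * f j x)%R
    = fun x => \sum_j (c j)%:E * (EFin \o f j) x.
  by apply/funext => x /=; rewrite -sumEFin.
apply: (integrable_sum mS) => j _; exact: (integrableZl mS (c j) (intf j)).
Qed.

Lemma Rintegral_lincomb (J : finType) (c : J -> R) (f : J -> T -> R) :
  (forall j, mu.-integrable S (EFin \o f j)) ->
  (\int[mu]_(x in S) (\sum_j c j * f j x)
    = \sum_j c j * \int[mu]_(x in S) f j x)%R.
Proof.
move=> intf; rewrite /Rintegral.
have intZ j : mu.-integrable S (fun x => (c j)%:E * (EFin \o f j) x).
  exact: (integrableZl mS (c j) (intf j)).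
under eq_integral do rewrite -sumEFin.
rewrite (integral_sum mS intZ) -sum_fine => [|j _].
  by apply: eq_bigr => j _; rewrite -(RintegralZl _ mS).
by apply: integrable_fin_num; last exact: intZ.
Qed.

Lemma integrable_quadr A : mu.-integrable S (EFin \o (quadr A : T -> R)).
Proof.
have -> : (quadr A : T -> R) = fun x : T =>
    (\sum_(p : 'I_n * 'I_n) A p.1 p.2 * (x 0 p.1 * x 0 p.2))%R.
  by apply/funext => x; rewrite quadrE pair_bigA.
by apply: integrable_lincomb => -[i j]; exact: sphere_integrable_coord2.
Qed.

Lemma integrable_dotp u : mu.-integrable S (EFin \o (fun x : T => dotp x u)).
Proof.
have -> : (fun x : T => dotp x u) = fun x => (\sum_i u 0 i * x 0 i)%R.
  by apply/funext => x; rewrite dotpE; apply: eq_bigr => i _; rewrite mulrC.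
by apply: integrable_lincomb => i; exact: sphere_integrable_coord.
Qed.

Definition sphere_moment : 'M[R]_n :=
  (\matrix_(i, j) \int[mu]_(x in S) (x 0 i * x 0 j))%R.

Lemma Rintegral_quadr A :
  (\int[mu]_(x in S) quadr A x = \sum_i \sum_j A i j * sphere_moment i j)%R.
Proof.
under eq_Rintegral do rewrite quadrE pair_bigA.
rewrite Rintegral_lincomb => [|[i j]]; last exact: sphere_integrable_coord2.
by rewrite pair_bigA; apply: eq_bigr => p _; rewrite mxE.
Qed.

Lemma sphere_momentE u w :
  ((u *m sphere_moment *m w^T) 0 0
    = \int[mu]_(x in S) (dotp x u * dotp x w))%R.
Proof.
have E x : (dotp x u * dotp x w = quadr (u^T *m w) x)%R.
  rewrite /quadr mulmxA -mulmxA [RHS]mxE big_ord1; congr (_ * _)%R.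
  exact: dotpC.
under eq_Rintegral do rewrite E.
rewrite Rintegral_quadr mxE exchange_big; apply: eq_bigr => j _ /=.
rewrite !mxE mulr_suml; apply: eq_bigr => i _.
by rewrite !mxE big_ord1 !mxE mulrAC.
Qed.

Lemma sphere_moment_sym : (sphere_moment^T = sphere_moment)%R.
Proof.
by apply/matrixP => i j; rewrite !mxE; under eq_Rintegral do rewrite mulrC.
Qed.

(* Invariance only sees the laws of the linear forms [x |-> dotp x u], which is
   enough for the first two moments. *)
Lemma sphere_law u (Q : 'M[R]_n) (f : R -> R) :
  (Q *m Q^T = 1%:M)%R -> (V *m Q <= V)%MS ->
  measurable_fun setT f -> (forall y, 0 <= f y)%R ->
  \int[mu]_(x in S) (f (dotp x (u *m Q^T)%R))%:E
    = \int[mu]_(x in S) (f (dotp x u))%:E.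
Proof.
move=> QQ VQ mf f_ge0.
have fS w : \int[mu]_(x in S) (f (dotp x w))%:E
    = \int[pushforward mu (fun x : T => dotp x w)]_y (f y)%:E.
  rewrite (ge0_integral_pushforward (measurable_dotp w)) //=; last first.
  - by move=> y _; rewrite lee_fin.
  - exact/measurable_EFinP.
  (* The complement of the sphere is negligible, so the integral extends to the whole space, where
     the change of variables applies. *)
  rewrite preimage_setT (@ge0_negligible_integral _ _ _ mu setT (~` S)) //=.
  - by rewrite setTD setCK.
  - exact: measurableC.
  - apply/measurable_EFinP; apply: measurableT_comp => //.
    exact: measurable_dotp.
  - by move=> y _; rewrite lee_fin.
  - by rewrite probability_setC // muS subee.
rewrite !fS.
unshelve refine (@eq_measure_integral _ _ R _
  (pushforward mu (fun x : T => dotp x u))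
  (pushforward mu (fun x : T => dotp x (u *m Q^T)%R)) _ _);
  try exact: measurable_dotp.
move=> A mA _.
rewrite /pushforward.
have mB : measurable ((fun x : T => dotp x u) @^-1` A).
  by rewrite -[X in measurable X]setTI; exact: measurable_dotp.
case: mu_sphere => _ /(_ Q QQ VQ _ mB) muQ.
apply: etrans muQ; congr (mu _); apply/seteqP.
by split=> x; rewrite /= dotp_mulmx.
Qed.

Definition sphere_mean : 'rV[R]_n := (\row_i \int[mu]_(x in S) x 0 i)%R.

Lemma Rintegral_poly2 (c : R) u A :
  (\int[mu]_(x in S) (c + dotp x u + quadr A x)
    = c + dotp sphere_mean u + \sum_i \sum_j A i j * sphere_moment i j)%R.
Proof.
have ic : mu.-integrable S (EFin \o (fun=> c)).
  by apply: (@sphere_integrable _ `|c|%R).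
rewrite RintegralD //; last 2 first.
- have -> : EFin \o (fun x : T => c + dotp x u)%R
      = (EFin \o fun=> c) \+ (EFin \o (fun x : T => dotp x u)).
    by apply/funext.
  by apply: integrableD => //; exact: integrable_dotp.
- exact: integrable_quadr.
rewrite RintegralD //; last exact: integrable_dotp.
rewrite Rintegral_quadr; congr (_ + _ + _)%R.
  by rewrite Rintegral_cst //; have /= -> := muS; rewrite mulr1.
have -> : (fun x : T => dotp x u) = fun x => (\sum_i u 0 i * x 0 i)%R.
  by apply/funext => x; rewrite dotpE; apply: eq_bigr => i _; rewrite mulrC.
rewrite Rintegral_lincomb => [|i]; last exact: sphere_integrable_coord.
by rewrite dotpE; apply: eq_bigr => i _; rewrite mxE mulrC.
Qed.

Lemma integrable_poly2 (c : R) u A :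
  mu.-integrable S (EFin \o (fun x : T => c + dotp x u + quadr A x)%R).
Proof.
have -> : EFin \o (fun x : T => c + dotp x u + quadr A x)%R
    = (EFin \o fun=> c) \+ (EFin \o (fun x : T => dotp x u))
      \+ (EFin \o (quadr A : T -> R)).
  by apply/funext.
apply: integrableD => //; last exact: integrable_quadr.
apply: integrableD => //; last exact: integrable_dotp.
by apply: (@sphere_integrable _ `|c|%R).
Qed.

(* [sphere_law] needs a nonnegative function, whence [(1 + y) ^+ 2] rather than [y]. *)
Lemma sphere_mean0 : sphere_mean = 0%R.
Proof.
apply/eqP; rewrite -dotp_eq0; set u := sphere_mean.
have N1N1 : (- 1%:M *m (- 1%:M)^T = 1%:M :> 'M[R]_n)%R.
  by rewrite linearN /= trmx1 mulNmx mulmxN opprK mulmx1.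
have VN1 : (V *m - 1%:M <= V)%MS by rewrite mulmxN mulmx1 eqmx_opp.
have mf : measurable_fun setT (fun y : R => (1 + y) ^+ 2)%R.
  by apply: measurable_funX; apply: measurable_funD.
have := @sphere_law u _ _ N1N1 VN1 mf (fun y => sqr_ge0 (1 + y)%R).
rewrite linearN /= trmx1 mulmxN mulmx1.
have E (w : 'rV[R]_n) (x : 'rV[R]_n) :
    ((1 + dotp x w) ^+ 2 = 1 + dotp x (2 *: w) + quadr (w^T *m w) x)%R.
  rewrite dotpZr sqrrD expr1n mul1r /quadr mulmxA -mulmxA.
  rewrite [in RHS]mxE big_ord1 -/(dotp w x) -/(dotp x w) (dotpC w) -expr2.
  by rewrite mulr_natl.
move=> /(congr1 fine); rewrite -!/(Rintegral _ _ _).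
under eq_Rintegral do rewrite E.
under [in RHS]eq_Rintegral do rewrite E.
have -> : ((- u)^T *m - u = u^T *m u)%R.
  by rewrite mulmxN linearN /= mulNmx opprK.
(* Constant and quadratic terms are even and cancel. The linear form tested is given by the mean [u]
   itself, so what remains is 2 |u|^2 = - 2 |u|^2. *)
rewrite !Rintegral_poly2 => /addIr/addrI.
rewrite scalerN dotpNr dotpZr => /eqP; rewrite -subr_eq0 -opprD oppr_eq0.
by rewrite -mulr2n mulrn_eq0 /= mulf_eq0 pnatr_eq0.
Qed.

End SphereMoments.

(** * The second moment as a multiple of the projection onto V *)

Section SphereMomentMatrix.
Variables (R : realType) (n : nat) (V : 'M[R]_n).
Variable mu : probability (borel_rV R n) R.
Hypotheses (V_neq0 : V != 0) (mu_sphere : sphere_measure V mu).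

(** Householder reflection along a = u - w, which lies in V, whence V is preserved. Equal norms give
    <a, a> = 2 <u, a>, so that u is sent to u - a = w. The case u = w is separate because a would
    vanish. *)
Lemma reflection_exists (u w : 'rV[R]_n) :
  (u <= V)%MS -> (w <= V)%MS -> dotp u u = dotp w w ->
  exists Q : 'M[R]_n,
    [/\ Q^T = Q, Q *m Q = 1%:M, (V *m Q <= V)%MS & u *m Q = w].
Proof.
move=> uV wV uw; have [<-|neq_uw] := eqVneq u w.
  by exists 1%:M; rewrite trmx1 !mulmx1.
have [a [a_neq0 aV ua uaw]] : exists a : 'rV[R]_n,
    [/\ dotp a a != 0, (a <= V)%MS, dotp a a = 2 * dotp u a & u - a = w].
  exists (u - w); split; last by rewrite opprB addrC subrK.
  - by rewrite dotp_eq0 subr_eq0.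
  - by rewrite addmx_sub ?eqmx_opp.
  - by rewrite dotpDl dotpNl !dotpBr -uw (dotpC w u); ring.
have aa : a *m a^T = (dotp a a)%:M by rewrite -mx11_scalar.
pose k := 2 / dotp a a.
exists (1%:M - k *: (a^T *m a)); split.
- by rewrite linearB /= trmx1 linearZ /= trmx_mul trmxK.
- rewrite mulmxBl mul1mx mulmxBr mulmx1 -scalemxAl -scalemxAr mulmxA.
  rewrite -(mulmxA a^T) aa mul_mx_scalar -scalemxAl !scalerA.
  suff -> : k * (k * dotp a a) = k + k.
    by rewrite scalerDl opprB addrK subrK.
  by rewrite /k divfK // mulr_natr.
- rewrite mulmxBr mulmx1 addmx_sub // eqmx_opp -scalemxAr scalemx_sub //.
  by rewrite mulmxA mulmx_sub.
rewrite mulmxBr mulmx1 -scalemxAr mulmxA.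
have -> : u *m a^T = (dotp u a)%:M by rewrite -mx11_scalar.
rewrite mul_scalar_mx scalerA -uaw; congr (_ - _).
suff -> : k * dotp u a = 1 by rewrite scale1r.
by rewrite /k mulrAC -ua divff.
Qed.

Local Notation M := (sphere_moment V mu).

(** A reflection of V taking u to w identifies the laws of the two linear forms, hence their second
    moments. *)
Lemma sphere_moment_isotropic u w : (u <= V)%MS -> (w <= V)%MS ->
  dotp u u = dotp w w -> dotp (u *m M) u = dotp (w *m M) w.
Proof.
move=> uV wV uw; have [Q [Qsym QQ VQ uQ]] := reflection_exists uV wV uw.
have mf : measurable_fun setT (fun y : R => y ^+ 2) by exact: measurable_funX.
have QQT : Q *m Q^T = 1%:M by rewrite Qsym.
have := sphere_law mu_sphere u QQT VQ mf (fun y => sqr_ge0 y).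
rewrite Qsym uQ /dotp !sphere_momentE // => wuE; rewrite /Rintegral; congr fine.
under eq_integral do rewrite -expr2.
by rewrite -wuE; apply: eq_integral => x _; rewrite expr2.
Qed.

(** Being constant on the spheres of V, the quadratic form of the second moment is a multiple of
    |x|^2 on V; polarization gives the bilinear statement. *)
Lemma sphere_moment_form v u w : unit_sphere V v ->
  (u <= V)%MS -> (w <= V)%MS ->
  dotp (u *m M) w = dotp (v *m M) v * dotp u w.
Proof.
move=> [vV v1] uV wV.
have qE x : (x <= V)%MS -> dotp (x *m M) x = dotp (v *m M) v * dotp x x.
  move=> xV; pose r := Num.sqrt (dotp x x).
  have r2 : r * r = dotp x x by rewrite -expr2 sqr_sqrtr ?dotp_ge0.
  rewrite (@sphere_moment_isotropic x (r *: v)) ?scalemx_sub //; last first.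
    by rewrite dotpZl dotpZr v1 mulr1.
  by rewrite -scalemxAl dotpZl dotpZr mulrA r2 mulrC.
have wu : dotp (w *m M) u = dotp (u *m M) w.
  by rewrite dotp_mulmx sphere_moment_sym dotpC.
have := qE (u + w) (addmx_sub uV wV).
rewrite mulmxDl !dotpDl !dotpDr (qE u) // (qE w) // wu (dotpC w u).
by move: (dotp _ _) (dotp _ _) (dotp _ _) (dotp _ _) => a b c d; lra.
Qed.

(** The factor comes from the trace: that of the moment is the integral of |x|^2 = 1, that of the
    projection is dim V. Vectors orthogonal to V are killed because they pair to zero with every
    point of the sphere. *)
Lemma sphere_moment_proj : M = (\rank V)%:R^-1 *: oprojmx V.
Proof.
have [v Sv] : exists v, unit_sphere V v.
  have /rowV0Pn[u uV u0] := V_neq0.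
  exists ((Num.sqrt (dotp u u))^-1 *: u); split; first exact: scalemx_sub.
  rewrite dotpZl dotpZr mulrA -expr2 exprVn sqr_sqrtr ?dotp_ge0 //.
  by rewrite mulVf // dotp_eq0.
pose c := dotp (v *m M) v.
have ME : M = c *: oprojmx V.
  apply: dotp_mx_inj => u w.
  have compl x y : dotp (x *m M) (y - y *m oprojmx V) = 0.
    rewrite /dotp sphere_momentE //.
    have -> : 0 = \int[mu]_(x in unit_sphere V) 0 :> R.
      by rewrite Rintegral_cst ?mul0r //; exact: measurable_unit_sphere.
    apply: eq_Rintegral => z; rewrite inE => -[zV _].
    have /orthocomplP/(_ z zV) yz := oprojmx_compl_sub y V.
    by rewrite (dotpC z (_ - _)) yz mulr0.
  have compl' x y : dotp (x *m M) y = dotp (x *m M) (y *m oprojmx V).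
    by apply/eqP; rewrite -subr_eq0 -dotpBr compl.
  rewrite compl' dotp_mulmx sphere_moment_sym dotpC compl'.
  rewrite (sphere_moment_form Sv) ?oprojmx_sub // -scalemxAr dotpZl.
  by rewrite -/c dotp_mulmx oprojmx_sym -mulmxA oprojmx_idem dotpC dotp_mulmx
    oprojmx_sym dotpC.
have trM : \tr M = 1.
  have -> : \tr M = \int[mu]_(x in unit_sphere V) quadr 1%:M x.
    rewrite Rintegral_quadr //; apply: eq_bigr => i _.
    rewrite (bigD1 i) //= !mxE eqxx mul1r big1 ?addr0 // => j ji.
    by rewrite mxE eq_sym (negPf ji) mul0r.
  transitivity (\int[mu]_(x in unit_sphere V) 1).
    by apply: eq_Rintegral => z; rewrite inE /quadr mulmx1 => -[_ zz]; exact: zz.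
  rewrite Rintegral_cst ?mul1r; last exact: measurable_unit_sphere.
  by have [/= -> _] := mu_sphere.
rewrite ME; congr (_ *: _).
move: trM; rewrite ME mxtraceZ mxtrace_oprojmx => cr.
by apply: (mulIf (x := (\rank V)%:R)); rewrite ?pnatr_eq0 ?mxrank_eq0 // cr
  mulVf // pnatr_eq0 mxrank_eq0.
Qed.

End SphereMomentMatrix.

(** * Frame operators of orbits *)

Section OrbitFrame.
Variables (R : realType) (gT : finGroupType) (G : {group gT}).
Local Notation nG := #|G|.
Local Notation aG := (regular_repr R G).
Implicit Types u v w : 'rV[R]_nG.

(** The matrices of the regular representation permute the basis G, so transposition inverts them;
    this is the invariance of the standard inner product. *)
Lemma regular_repr_tr g : g \in G -> (aG g)^T = aG (g^-1)%g.
Proof.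
move=> Gg; apply/matrixP => i j; rewrite mxE /= /regular_mx !mxE eqxx /=.
congr _%:R; congr nat_of_bool; apply/eqP/eqP => [->|->].
  by rewrite gring_indexK ?groupM ?enum_valP // mulgK gring_valK.
by rewrite gring_indexK ?groupM ?groupV ?enum_valP // mulgKV gring_valK.
Qed.

Lemma gactM g h u : g \in G -> h \in G -> gact (g * h)%g u = gact g (gact h u).
Proof.
by move=> Gg Gh; rewrite /gact invMg repr_mxM ?groupV // mulmxA.
Qed.

Lemma gact1 u : gact 1%g u = u.
Proof. by rewrite /gact invg1 repr_mx1 mulmx1. Qed.

Lemma gactK g u : g \in G -> gact (g^-1)%g (gact g u) = u.
Proof. by move=> Gg; rewrite -gactM ?groupV // mulVg gact1. Qed.

Lemma gact_dotp g u w : g \in G -> dotp (gact g u) w = dotp u (gact (g^-1)%g w).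
Proof.
by move=> Gg; rewrite /gact dotp_mulmx regular_repr_tr ?groupV // invgK.
Qed.

Lemma gact_isometry g u w : g \in G ->
  dotp (gact g u) (gact g w) = dotp u w.
Proof. by move=> Gg; rewrite gact_dotp // gactK. Qed.

Lemma gact_module (V : 'M[R]_nG) g u :
  mxmodule aG V -> g \in G -> (u <= V)%MS -> (gact g u <= V)%MS.
Proof. by move=> Vm Gg uV; apply: mxmodule_trans; rewrite ?groupV. Qed.

Lemma gact_sum_mul (f : 'rV[R]_nG -> R) h v : h \in G ->
  \sum_(g in G) f (gact (h * g)%g v) = \sum_(g in G) f (gact g v).
Proof.
move=> Gh; rewrite [RHS](reindex_inj (mulgI h)) /=.
by apply: eq_bigl => g; rewrite groupMl.
Qed.

Lemma gorbitP v x : reflect (exists2 g, g \in G & x = gact g v)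
  (x \in gorbit v).
Proof. by apply: (iffP (imfsetP _ _ _ _)) => -[g Gg ->]; exists g. Qed.

(** By translation all fibres of g |-> g v over the orbit have the size [s] of the stabilizer; the
    case f = 1 shows that [s] times the size of the orbit is |G|. *)
Lemma gorbit_mean (f : 'rV[R]_nG -> R) v :
  #|` gorbit v|%:R^-1 * \sum_(x <- gorbit v) f x
    = nG%:R^-1 * \sum_(g in G) f (gact g v).
Proof.
pose s := \sum_(g in G) (gact g v == v)%:R : R.
have fiber x : x \in gorbit v -> \sum_(g in G) (gact g v == x)%:R = s.
  move=> /gorbitP[h Gh ->]; rewrite -(gact_sum_mul (fun y => (y == _)%:R) _ Gh).
  apply: eq_bigr => g Gg; rewrite gactM //; congr (_%:R : R).
  by congr nat_of_bool; apply: (inj_eq (can_inj (fun u => gactK u Gh))).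
have sumE (F : 'rV[R]_nG -> R) :
    \sum_(g in G) F (gact g v) = s * \sum_(x <- gorbit v) F x.
  transitivity (\sum_(x <- gorbit v) (\sum_(g in G) (gact g v == x)%:R) * F x).
    under [RHS]eq_bigr do rewrite mulr_suml.
    rewrite exchange_big /=; apply: eq_bigr => g Gg.
    have gv : gact g v \in gorbit v by apply/gorbitP; exists g.
    rewrite (bigD1_seq (gact g v)) ?fset_uniq //= eqxx mul1r big1 ?addr0 //.
    by move=> x /negPf; rewrite eq_sym => ->; rewrite mul0r.
  by rewrite mulr_sumr; apply: eq_big_seq => x /fiber ->.
have nE : nG%:R = s * #|` gorbit v|%:R :> R.
  have := sumE (fun=> 1); rewrite sumr_const => ->; congr (_ * _).
  by rewrite big_const_seq count_predT iter_addr_0.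
have : nG%:R != 0 :> R by rewrite pnatr_eq0 -lt0n cardG_gt0.
rewrite sumE {}nE mulf_eq0 negb_or => /andP[s0 X0].
by field; rewrite s0 X0.
Qed.

Definition frame_mx v : 'M[R]_nG :=
  nG%:R^-1 *: \sum_(g in G) (gact g v)^T *m gact g v.

Lemma frame_mx_dotp v u w :
  dotp (u *m frame_mx v) w
    = nG%:R^-1 * \sum_(g in G) dotp u (gact g v) * dotp (gact g v) w.
Proof.
rewrite /frame_mx -scalemxAr dotpZl mulmx_sumr; congr (_ * _).
rewrite dotpC dotp_sumr; apply: eq_bigr => g _; rewrite dotpC mulmxA.
by rewrite [u *m _]mx11_scalar mul_scalar_mx dotpZl.
Qed.

Lemma frame_mx_sym v : (frame_mx v)^T = frame_mx v.
Proof.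
rewrite /frame_mx linearZ /= linear_sum; congr (_ *: _).
by apply: eq_bigr => g _ /=; rewrite trmx_mul trmxK.
Qed.

(** Conjugation by g only permutes the summands of the frame operator. *)
Lemma frame_mx_comm v g : g \in G ->
  frame_mx v *m aG g = aG g *m frame_mx v.
Proof.
move=> Gg; apply: dotp_mx_inj => u w.
have -> : u *m (frame_mx v *m aG g) = gact (g^-1)%g (u *m frame_mx v).
  by rewrite /gact invgK mulmxA.
have -> : u *m (aG g *m frame_mx v) = gact (g^-1)%g u *m frame_mx v.
  by rewrite /gact invgK mulmxA.
rewrite gact_dotp ?groupV // invgK !frame_mx_dotp; congr (_ * _).
rewrite -(gact_sum_mul (fun x => dotp u x * dotp x (gact g w)) v Gg).
apply: eq_bigr => h Gh; rewrite gactM // gact_isometry //; congr (_ * _).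
by rewrite dotpC gact_dotp // dotpC.
Qed.

End OrbitFrame.

(** * Polynomial functions of degree at most two *)

Section QuadraticPolynomials.
Variables (R : realType) (n : nat).

(** Peeling off one variable at a time reduces the monomials of degree at most two to 1, x_i and x_i
    x_j. *)
Lemma monomial_split (e : 'I_n -> nat) k : (\sum_i e i = k.+1)%N ->
  exists i, exists2 e' : 'I_n -> nat, (\sum_i e' i = k)%N
    & forall x : 'I_n -> R, \prod_j x j ^+ e j = x i * \prod_j x j ^+ e' j.
Proof.
move=> ek; have [i ei] : exists i, (0 < e i)%N.
  apply: contrapT => /forallNP e0; move: ek; rewrite big1 // => i _.
  by apply/eqP; rewrite -leqn0 leqNgt; apply/negP.
exists i, (fun j => if j == i then (e i).-1 else e j).
  move: ek; rewrite (bigD1 i) //= -(prednK ei) addSn => -[<-].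
  rewrite (bigD1 i) //= eqxx; congr (_ + _)%N.
  by apply: eq_bigr => j /negPf ->.
move=> x; rewrite (bigD1 i) //= [in RHS](bigD1 i) //= eqxx mulrA.
rewrite -exprS prednK //; congr (_ * _).
by apply: eq_bigr => j /negPf ->.
Qed.

Lemma quadr_delta i j (x : 'rV[R]_n) : quadr (delta_mx i j) x = x 0 i * x 0 j.
Proof.
rewrite quadrE (bigD1 i) //= [X in _ + X]big1 => [|k ki]; last first.
  by rewrite big1 // => l _; rewrite mxE (negPf ki) mul0r.
rewrite (bigD1 j) //= [X in _ + X + _]big1 => [|l lj]; last first.
  by rewrite mxE (negPf lj) andbF mul0r.
by rewrite mxE !eqxx mul1r !addr0.
Qed.

Lemma quadrD A B (x : 'rV[R]_n) : quadr (A + B) x = quadr A x + quadr B x.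
Proof. by rewrite /quadr mulmxDr mulmxDl mxE. Qed.

Lemma quadrZ a A (x : 'rV[R]_n) : quadr (a *: A) x = a * quadr A x.
Proof. by rewrite /quadr -scalemxAr -scalemxAl mxE. Qed.

Lemma monomial_poly2 (e : 'I_n -> nat) : (\sum_i e i <= 2)%N ->
  exists c u A, forall x : 'rV[R]_n,
    \prod_i x 0 i ^+ e i = c + dotp x u + quadr A x.
Proof.
have quadr0 x : quadr (0 : 'M[R]_n) x = 0.
  by rewrite /quadr mulmx0 mul0mx mxE.
have prod0 (f : 'I_n -> nat) : (\sum_i f i = 0)%N ->
    forall x : 'I_n -> R, \prod_i x i ^+ f i = 1.
  move=> /eqP; rewrite sum_nat_eq0 => /forallP f0 x.
  by rewrite big1 // => i _; rewrite (eqP (implyP (f0 i) isT)).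
have coordE i (x : 'rV[R]_n) : x 0 i = dotp x (delta_mx 0 i).
  by rewrite /dotp trmx_delta -colE mxE.
case E : (\sum_i e i)%N => [|[|[|//]]] _.
- by exists 1, 0, 0 => x; rewrite prod0 // dotp0r quadr0 !addr0.
- have [i [f f0 fE]] := monomial_split E.
  exists 0, (delta_mx 0 i), 0 => x.
  by rewrite fE prod0 // quadr0 addr0 add0r mulr1 coordE.
have [i [f f1 fE]] := monomial_split E; have [j [h h0 hE]] := monomial_split f1.
exists 0, 0, (delta_mx i j) => x.
by rewrite fE hE prod0 // mulr1 dotp0r !add0r quadr_delta.
Qed.

Lemma poly_eval_poly2 (p : mpoly n R) : (msize p <= 3)%N ->
  exists c u A, forall x : 'rV[R]_n,
    poly_eval p x = c + dotp x u + quadr A x.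
Proof.
move=> p3; rewrite /poly_eval.
under eq_exists => c do under eq_exists => u do under eq_exists => A do
  under eq_forall do rewrite mevalE.
have : forall m, m \in msupp p -> (mdeg m <= 2)%N.
  by move=> m /msize_mdeg_lt /leq_trans/(_ p3).
(* The induction runs over the list of monomials only; [p], and with it the coefficients, stays
   fixed. *)
elim: (msupp p : seq _) => [|m s IHs] s2.
  exists 0, 0, 0 => x.
  by rewrite big_nil dotp0r /quadr mulmx0 mul0mx mxE !addr0.
have [|c [u [A E]]] := IHs; first by move=> l ls; rewrite s2 // inE ls orbT.
have [|c' [u' [A' E']]] := @monomial_poly2 m; first by rewrite -mdegE s2 ?mem_head.
exists (mcoeff m p * c' + c), (mcoeff m p *: u' + u), (mcoeff m p *: A' + A).
move=> x; rewrite big_cons E E' dotpDr dotpZr quadrD quadrZ; ring.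
Qed.

End QuadraticPolynomials.

(** * The 2-design condition as an equation for the frame operator *)

Section DesignFrame.
Variables (R : realType) (gT : finGroupType) (G : {group gT}).
Local Notation aG := (regular_repr R G).
Variables (V : 'M[R]_#|G|) (mu : probability (borel_rV R #|G|) R).
Hypotheses (V_module : mxmodule aG V) (V_neq0 : V != 0).
Hypotheses (V_sub : (V <= regular0 R G)%MS) (mu_sphere : sphere_measure V mu).

(** The sum is G-invariant and lies in V, which is orthogonal to the invariants; hence it is
    orthogonal to itself. *)
Lemma gact_sum0 v : (v <= V)%MS -> \sum_(g in G) gact g v = 0.
Proof.
move=> vV; set s := \sum_(g in G) _.
have sV : (s <= V)%MS by apply: summx_sub => g Gg; apply: gact_module.
have s_fix : (s <= rfix_mx aG G)%MS.
  apply/rfix_mxP => h Gh; rewrite -[h in aG h]invgK -/(gact _ _).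
  rewrite /gact mulmx_suml [RHS](reindex_inj (mulgI h^-1%g)) /=.
  apply: eq_big => g; first by rewrite groupMl ?groupV.
  by move=> Gg; rewrite -!/(gact _ _) gactM ?groupV.
apply/eqP; rewrite -dotp_eq0; apply/eqP.
exact: (orthocomplP _ _ (submx_trans sV V_sub)).
Qed.

Lemma orbit_mean_poly2 v c u A : (v <= V)%MS ->
  #|G|%:R^-1 * \sum_(g in G) (c + dotp (gact g v) u + quadr A (gact g v))
    = c + \sum_i \sum_j A i j * frame_mx v i j.
Proof.
move=> vV; rewrite !big_split /= sumr_const !mulrDr -[c *+ _]mulr_natl mulrA.
rewrite mulVf ?pnatr_eq0 -?lt0n ?cardG_gt0 // mul1r.
have -> : \sum_(g in G) dotp (gact g v) u = 0.
  under eq_bigr do rewrite dotpC.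
  by rewrite -dotp_sumr gact_sum0 // dotp0r.
rewrite mulr0 addr0; congr (_ + _); rewrite mulr_sumr.
transitivity (\sum_(g in G) \sum_i \sum_j
    #|G|%:R^-1 * (A i j * (gact g v 0 i * gact g v 0 j))).
  apply: eq_bigr => g _; rewrite quadrE mulr_sumr; apply: eq_bigr => i _.
  by rewrite mulr_sumr.
rewrite exchange_big; apply: eq_bigr => i _ /=.
rewrite exchange_big; apply: eq_bigr => j _ /=.
rewrite mxE summxE mulrCA !mulr_sumr; apply: eq_bigr => g _.
by rewrite [(_^T *m _) i j]mxE big_ord1 [_^T i _]mxE.
Qed.

(** On c + <x, u> + [quadr A x] both averages lose the linear term and differ only in the matrix
    paired with A; the monomials x_i x_j recover the entries of that matrix. *)
Lemma spherical_design_frame v : unit_sphere V v ->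
  spherical_design V mu 2 (gorbit v) <->
    frame_mx v = (\rank V)%:R^-1 *: oprojmx V.
Proof.
move=> [vV v1]; rewrite -(sphere_moment_proj V_neq0 mu_sphere).
have int2 c u A : (\int[mu]_(x in unit_sphere V) (c + dotp x u + quadr A x)%:E
    = (c + \sum_i \sum_j A i j * sphere_moment V mu i j)%:E)%E.
  have := Rintegral_poly2 mu_sphere c u A.
  rewrite sphere_mean0 // dotp0l addr0 => <-; rewrite /Rintegral fineK //.
  apply: integrable_fin_num; first exact: measurable_unit_sphere.
  exact: integrable_poly2.
split=> [[_ design]|frameE].
  apply/matrixP => i j; pose p := mpolyX R (mnm_add (mnm1 i) (mnm1 j)).
  have pE x : poly_eval p x = 0 + dotp x 0 + quadr (delta_mx i j) x.
    rewrite dotp0r !add0r quadr_delta /poly_eval mevalX.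
    under eq_bigr do rewrite mnmDE exprD !mnm1E.
    rewrite big_split; congr (_ * _).
      rewrite (bigD1 i) //= eqxx expr1 big1 ?mulr1 // => k.
      by rewrite eq_sym => /negPf ->.
    rewrite (bigD1 j) //= eqxx expr1 big1 ?mulr1 // => k.
    by rewrite eq_sym => /negPf ->.
  have := design p; rewrite msizeX mdegD !mdeg1 => /(_ isT).
  under eq_integral do rewrite pE.
  rewrite int2 gorbit_mean; under eq_bigr do rewrite pE.
  rewrite orbit_mean_poly2 // => -[/addrI].
  have deltaE (B : 'M[R]_#|G|) :
      \sum_k \sum_l delta_mx i j k l * B k l = B i j.
    rewrite (bigD1 i) //= [X in _ + X]big1 => [|k ki]; last first.
      by rewrite big1 // => l _; rewrite mxE (negPf ki) mul0r.
    rewrite (bigD1 j) //= [X in _ + X + _]big1 => [|l lj]; last first.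
      by rewrite mxE (negPf lj) andbF mul0r.
    by rewrite mxE !eqxx mul1r !addr0.
  by rewrite !deltaE.
split=> [x /gorbitP[g Gg ->]|p p3].
  by split; [exact: gact_module | rewrite gact_isometry].
have [c [u [A E]]] := poly_eval_poly2 p3.
under eq_integral do rewrite E.
rewrite int2 gorbit_mean; under eq_bigr do rewrite E.
by rewrite orbit_mean_poly2 // frameE.
Qed.

End DesignFrame.

(** * Isotypic components *)

Section IsotypicDecomposition.
Variables (R : realType) (gT : finGroupType) (G : {group gT}).
Local Notation aG := (regular_repr R G).
Implicit Types U : 'M[R]_#|G|.

Lemma orthocompl_gact U g u : mxmodule aG U -> g \in G ->
  (u <= orthocompl U)%MS -> (gact g u <= orthocompl U)%MS.
Proof.
move=> Um Gg /orthocomplP uU; apply/orthocomplP => w wU.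
by rewrite gact_dotp // uU // gact_module ?groupV.
Qed.

Lemma orthocompl_module U : mxmodule aG U -> mxmodule aG (orthocompl U).
Proof.
move=> Um; apply/mxmoduleP => g Gg; apply/row_subP => i; rewrite row_mul.
have := @orthocompl_gact U (g^-1)%g (row i (orthocompl U)) Um.
by rewrite groupV /gact invgK => /(_ Gg); apply; exact: row_sub.
Qed.

Lemma oprojmx_comm U g : mxmodule aG U -> g \in G ->
  oprojmx U *m aG g = aG g *m oprojmx U.
Proof.
move=> Um Gg; apply/row_matrixP => i; rewrite !rowE.
rewrite (mulmxA _ (oprojmx U)) (mulmxA _ (aG g)).
move: (delta_mx 0 i : 'rV[R]_#|G|) => u.
have uE : u = u *m oprojmx U + (u - u *m oprojmx U) by rewrite addrC subrK.
have uUg : (u *m oprojmx U *m aG g <= U)%MS.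
  by rewrite mxmodule_trans ?oprojmx_sub.
have u'g : ((u - u *m oprojmx U) *m aG g <= orthocompl U)%MS.
  by rewrite mxmodule_trans ?orthocompl_module ?oprojmx_compl_sub.
have -> : u *m aG g = u *m oprojmx U *m aG g + (u - u *m oprojmx U) *m aG g.
  by rewrite -mulmxDl -uE.
by rewrite [RHS]mulmxDl (oprojmx_id uUg) (oprojmx_0 u'g) addr0.
Qed.

Variables (V : 'M[R]_#|G|) (I : finType) (W : I -> 'M[R]_#|G|).
Hypotheses (V_module : mxmodule aG V) (W_types : irr_types V W).
Local Notation Vi i := (isotypic_component V (W i)).

Lemma isotypic_module i : mxmodule aG (Vi i).
Proof. by rewrite capmx_module // component_mx_module. Qed.

Lemma isotypic_sub i : (Vi i <= V)%MS.
Proof. exact: capmxSl. Qed.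

Lemma commuting_isotypic (f : 'M[R]_#|G|) i :
  (forall g, g \in G -> aG g *m f = f *m aG g) -> (V *m f <= V)%MS ->
  (Vi i *m f <= Vi i)%MS.
Proof.
case: W_types => simW _ _ fG Vf; rewrite sub_capmx.
rewrite (submx_trans (submxMr f (capmxSl _ _)) Vf).
apply: submx_trans (submxMr f (capmxSr _ _)) _.
apply: hom_component_mx; first by case: (simW i).
by apply/hom_mxP => g Gg; rewrite -mulmxA fG // mulmxA.
Qed.

(** The projection onto the full component of type j commutes with G, so it maps the component of
    type i into the intersection of the two, which is 0 because the types differ. *)
Lemma isotypic_orth i j (u w : 'rV[R]_#|G|) : i != j ->
  (u <= Vi i)%MS -> (w <= Vi j)%MS -> dotp u w = 0.
Proof.
case: W_types => simW isoW _ neq_ij uV wV.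
pose C k := component_mx aG (W k).
have Cij : (C i :&: C j = 0)%MS.
  apply: component_mx_disjoint; [by case: (simW i)|by case: (simW j)|].
  apply: contra neq_ij => /component_mx_isoP iso_ij.
  by apply/eqP/isoW/iso_ij; [case: (simW i)|case: (simW j)].
have uP : u *m oprojmx (C j) = 0.
  apply/eqP; rewrite -submx0 -Cij sub_capmx oprojmx_sub andbT.
  have uC : (u <= C i)%MS by apply: submx_trans uV (capmxSr _ _).
  apply: submx_trans (submxMr _ uC) _; apply: hom_component_mx.
    by case: (simW i).
  apply/hom_mxP => g Gg; rewrite -mulmxA -oprojmx_comm ?mulmxA //.
  exact: component_mx_module.
have wC : (w <= C j)%MS by apply: submx_trans wV (capmxSr _ _).
by rewrite -(oprojmx_id wC) dotpC dotp_mulmx oprojmx_sym uP dotp0r.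
Qed.

(** Otherwise the orthogonal complement of the sum in V would contain a simple module; its type is
    among the [W i], so it would lie in the sum as well. *)
Lemma isotypic_sum : (V <= \sum_i Vi i)%MS.
Proof.
case: W_types => simW _ exW; pose X := (\sum_i Vi i)%MS.
have Xm : mxmodule aG X by apply: sumsmx_module => i _; exact: isotypic_module.
pose Y := (V :&: orthocompl X)%MS.
have [Y0|] := eqVneq Y 0.
  apply/row_subP => k; set u := row k V.
  have uV : (u <= V)%MS by exact: row_sub.
  suff <- : u *m oprojmx X = u by exact: oprojmx_sub.
  apply/esym/eqP; rewrite -subr_eq0 -submx0 -Y0 sub_capmx oprojmx_compl_sub.
  rewrite andbT addmx_sub // eqmx_opp (submx_trans (oprojmx_sub _ _)) //.
  by apply/sumsmx_subP => i _; exact: isotypic_sub.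
move=> Y0; have Ym : mxmodule aG Y by rewrite capmx_module ?orthocompl_module.
apply: (mxsimple_exists Ym Y0) => -[U simU]; rewrite sub_capmx => /andP[UV UX].
have [i iso_i] := exW U simU UV.
have UXs : (U <= X)%MS.
  apply: (sumsmx_sup i) => //.
  by rewrite sub_capmx UV mx_iso_component //; case: (simW i).
case: simU => _ U0 _; case/negP: U0.
by rewrite -submx0 -(capmx_orthocompl X) sub_capmx UXs.
Qed.

Lemma oprojmx_isotypic (u : 'rV[R]_#|G|) i j : (u <= Vi i)%MS ->
  u *m oprojmx (Vi j) = if i == j then u else 0.
Proof.
case: eqVneq => [<- /oprojmx_id //|neq_ij uV].
by apply: oprojmx_0; apply/orthocomplP => w; exact: (isotypic_orth neq_ij).
Qed.

Lemma isotypic_decomp (u : 'rV[R]_#|G|) :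
  (u <= V)%MS -> u = \sum_i u *m oprojmx (Vi i).
Proof.
move=> uV; have /sub_sumsmxP[x ux] := submx_trans uV isotypic_sum.
rewrite {1}ux; apply: eq_bigr => j _; rewrite ux mulmx_suml (bigD1 j) //=.
rewrite (oprojmx_isotypic (i := j)) ?submxMl // eqxx big1 ?addr0 // => i ij.
by rewrite (oprojmx_isotypic (i := i)) ?submxMl // (negPf ij).
Qed.

Lemma oprojmx_sum_isotypic : oprojmx V = \sum_i oprojmx (Vi i).
Proof.
apply/row_matrixP => k; rewrite !rowE.
rewrite [LHS]isotypic_decomp ?oprojmx_sub // mulmx_sumr.
apply: eq_bigr => i _; apply/eqP; rewrite eq_sym -subr_eq0 -mulmxBl.
apply/eqP/oprojmx_0; apply: submx_trans (oprojmx_compl_sub _ V) _.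
apply/row_subP => j; apply/orthocomplP => w wV.
by apply: (orthocomplP _ _ (row_sub j _)); apply: submx_trans wV (isotypic_sub i).
Qed.

Lemma rank_isotypic_sum : \rank V = (\sum_i \rank (Vi i))%N.
Proof.
apply/eqP; rewrite -(eqr_nat R) natr_sum -mxtrace_oprojmx.
rewrite oprojmx_sum_isotypic raddf_sum; apply/eqP/eq_bigr => i _.
exact: mxtrace_oprojmx.
Qed.

End IsotypicDecomposition.

(** * The frame operator in matrix coordinates *)

Section MatrixModel.
Variables (R : realType) (gT : finGroupType) (G : {group gT}).
Local Notation aG := (regular_repr R G).
Variables (W U : 'M[R]_#|G|) (mm : matrix_model W U).
Local Notation D := (fs_alg R (mm_type mm)).
Local Notation n := (mm_n mm).
Local Notation m := (mm_m mm).
Local Notation d := (fs_dim (mm_type mm)).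
Local Notation iso := (@mm_iso _ _ _ _ _ mm).
Local Notation rho := (mm_rho mm).
Implicit Types A B N : 'M[D]_(n, m).

Lemma mm_isoD A B : iso (A + B) = iso A + iso B.
Proof. by have := mm_iso_linear (m := mm) 1 A B; rewrite real_scale1 scale1r. Qed.

Lemma mm_iso0 : iso 0 = 0.
Proof. by apply: (addrI (iso 0)); rewrite -mm_isoD !addr0. Qed.

Lemma mm_isoZ r A : iso (real_scale r A) = r *: iso A.
Proof. by have := mm_iso_linear (m := mm) r A 0; rewrite addr0 mm_iso0 addr0. Qed.

Lemma mm_iso_sub A : (iso A <= U)%MS.
Proof. by apply/(mm_iso_image mm); exists A. Qed.

Lemma mm_iso_dotp A B : dotp (iso A) (iso B) = mip A B.
Proof.
have := mm_iso_isometric (m := mm) (A + B).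
rewrite mm_isoD frob_mip mipDr !(mipC (A + B)) !mipDr -!frob_mip.
rewrite !dotpDl !dotpDr !mm_iso_isometric (mipC B A) (dotpC (iso B) (iso A)).
by move: (dotp _ _) (mip _ _) (frob_sqnorm _) (frob_sqnorm _) => a b c e; lra.
Qed.

Lemma mm_iso_inj : injective iso.
Proof.
move=> A B AB; apply: mip_inj => C.
by rewrite -!mm_iso_dotp AB.
Qed.

Lemma mm_isoP u : (u <= U)%MS -> exists A, u = iso A.
Proof. by move/(mm_iso_image mm). Qed.

(** [mm_iso] carries the basis [mx_basis] to an orthonormal basis of [U]. *)
Lemma mm_parseval u w :
  \sum_(x : mx_index (mm_type mm) n m)
      dotp u (iso (mx_basis R x)) * dotp (iso (mx_basis R x)) w
    = dotp (u *m oprojmx U) w.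
Proof.
have [A uA] := mm_isoP (oprojmx_sub u U).
have [B wB] := mm_isoP (oprojmx_sub w U).
have isoE y C : dotp y (iso C) = dotp (y *m oprojmx U) (iso C).
  by rewrite dotp_mulmx oprojmx_sym oprojmx_id // mm_iso_sub.
have uE C : dotp u (iso C) = mip A C by rewrite isoE uA mm_iso_dotp.
have wE C : dotp (iso C) w = mip C B by rewrite dotpC isoE wB mm_iso_dotp mipC.
rewrite uA wE -mx_parseval; apply: eq_bigr => x _.
by rewrite uE wE (mipC A).
Qed.

Lemma mm_rank : \rank U = (n * m * d)%N.
Proof.
apply/eqP; rewrite -(eqr_nat R) -mxtrace_oprojmx; apply/eqP.
have PE : oprojmx U = \sum_(x : mx_index (mm_type mm) n m)
    (iso (mx_basis R x))^T *m iso (mx_basis R x).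
  apply: dotp_mx_inj => u w; rewrite -mm_parseval mulmx_sumr dotpC dotp_sumr.
  apply: eq_bigr => x _; rewrite mulmxA [u *m _]mx11_scalar mul_scalar_mx.
  by rewrite dotpZr (dotpC w).
rewrite PE raddf_sum -card_mx_index -[in RHS]sum1_card natr_sum /=.
apply: eq_bigr => x _; rewrite mxtrace_mulC /mxtrace big_ord1.
by rewrite -/(dotp _ _) mm_iso_dotp mip_basis_orth eqxx.
Qed.

Lemma mip_rho g A B : g \in G -> mip (rho g *m A) (rho g *m B) = mip A B.
Proof.
move=> Gg; rewrite /mip adjmxM mulmxA -(mulmxA _ _ (rho g)).
by rewrite (mm_rho_O mm Gg) mulmx1.
Qed.

(* [sum_x <e_x, (e_x . a) T>] is the trace of right multiplication by [a] against
   the frame operator [T]; averaging over [G] reduces it to the component [N]. *)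
Lemma frame_mx_trace v N (a : 'M[D]_m) : v *m oprojmx U = iso N ->
  \sum_(x : mx_index (mm_type mm) n m)
      dotp (iso (mx_basis R x) *m frame_mx v) (iso (mx_basis R x *m a))
    = mip N (N *m adjmx a).
Proof.
move=> vN.
(* Pairing with an element of [U] only sees the projection of g v, whose coordinates are rho(g) N by
   equivariance. *)
have gvE g A : g \in G -> dotp (gact g v) (iso A) = mip (rho g *m N) A.
  move=> Gg; rewrite gact_dotp // -mm_iso_equivariant ?groupV //.
  rewrite -(oprojmx_id (mm_iso_sub _)) -{1}oprojmx_sym -dotp_mulmx vN.
  rewrite mm_iso_equivariant ?groupV // -gact_dotp // -mm_iso_equivariant //.
  by rewrite mm_iso_dotp.
under eq_bigr do rewrite frame_mx_dotp.
rewrite -mulr_sumr exchange_big /=.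
have nG0 : #|G|%:R != 0 :> R by rewrite pnatr_eq0 -lt0n cardG_gt0.
apply: (mulfI nG0); rewrite mulVKf // mulr_natl -sumr_const.
(* Every g contributes the same amount because rho(g) is in O_D(n), so the average over G collapses
   to one term. *)
apply: eq_bigr => g Gg; rewrite -(mip_rho _ _ Gg) mulmxA -mx_parseval.
apply: eq_bigr => x _; rewrite (dotpC (iso _)) !gvE // (mipC _ (mx_basis R x)).
by congr (_ * _); rewrite (mip_mulr (mx_basis R x)) adjmxK mipC.
Qed.

Lemma frame_mx_gram v N c : v *m oprojmx U = iso N ->
  (forall u : 'rV[R]_#|G|, (u <= U)%MS -> u *m frame_mx v = c *: u) ->
  adjmx N *m N = real_scale (c * (n * d)%:R) (1%:M : 'M[D]_m).
Proof.
move=> vN Tc; apply: mip_inj => a.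
rewrite /mip real_scale_mulr mulmx1 re_tr_scale re_tr_mulC -mulmxA.
rewrite -[LHS]/(mip N (N *m adjmx a)) -(frame_mx_trace _ vN).
under eq_bigr do rewrite Tc ?mm_iso_sub // dotpZl mm_iso_dotp.
rewrite -mulr_sumr -mulrA; congr (_ * _).
under eq_bigr do rewrite -[X in mip X _]mulmx1.
by rewrite mip_basis_mul adjmx1 mul1mx re_tr_adj.
Qed.

(** In coordinates f is an m x m array of G-equivariant real-linear maps D^n -> D^n between columns.
    By [mm_End] each is right multiplication by an element of D, and these elements are the entries
    of b. *)
Lemma commutant_right_mul (f : 'M[R]_#|G|) :
  (forall g, g \in G -> aG g *m f = f *m aG g) -> (U *m f <= U)%MS ->
  exists b : 'M[D]_m, forall A, iso A *m f = iso (A *m b).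
Proof.
move=> fG Uf.
have /choice[F FE] : forall A, exists B, iso A *m f = iso B.
  by move=> A; apply: mm_isoP; apply: submx_trans (submxMr f (mm_iso_sub A)) Uf.
have F_lin r A B : F (real_scale r A + B) = real_scale r (F A) + F B.
  apply: mm_iso_inj; rewrite -FE !mm_iso_linear mulmxDl -scalemxAl.
  by rewrite !FE.
have F_rho g A : g \in G -> F (rho g *m A) = rho g *m F A.
  move=> Gg; apply: mm_iso_inj; rewrite -FE !mm_iso_equivariant // -FE.
  by rewrite /gact -!mulmxA fG ?groupV.
have FD A B : F (A + B) = F A + F B.
  by have := F_lin 1 A B; rewrite !real_scale1.
have F0 : F 0 = 0 by apply: (addrI (F 0)); rewrite -FD !addr0.
have F_entry l l' : exists a : D, forall x : 'cV[D]_n,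
    F (x *m delta_mx 0 l) *m delta_mx l' 0 = x *m a%:M.
  (* The map inserts x as column l, applies [F] and reads off column l'. *)
  apply: (mm_End (f := fun x => F (x *m delta_mx 0 l) *m delta_mx l' 0)).
    move=> r x y; rewrite mulmxDl real_scale_mull F_lin mulmxDl.
    by rewrite real_scale_mull.
  by move=> g x Gg; rewrite -mulmxA F_rho // mulmxA.
pose bE l := choice (F_entry l); pose b l := projT1 (bE l).
exists (\matrix_(l, l') b l l') => A; rewrite FE; congr (iso _).
have AE : A = \sum_l col l A *m delta_mx 0 l.
  rewrite -{1}[A]mulmx1 mx1_sum_delta mulmx_sumr; apply: eq_bigr => l _.
  by rewrite colE -mulmxA mul_delta_mx.
have -> : F A = \sum_l F (col l A *m delta_mx 0 l).
  by rewrite {1}AE (big_morph F FD F0).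
apply/matrixP => k l'; rewrite summxE [RHS]mxE; apply: eq_bigr => l _.
have /(congr1 (fun C : 'cV[D]_n => C k 0)) := projT2 (bE l) l' (col l A).
by rewrite -/(b l) -colE !mxE big_ord1 !mxE eqxx mulr1n.
Qed.

(** With T = R_b the trace identity computes n d <b, a> for every a, and the Gram hypothesis turns
    the result into n d <c 1, a>; hence b = c 1. *)
Lemma frame_mx_scalar v N c : v *m oprojmx U = iso N ->
  (U *m frame_mx v <= U)%MS ->
  adjmx N *m N = real_scale (c * (n * d)%:R) (1%:M : 'M[D]_m) ->
  forall u : 'rV[R]_#|G|, (u <= U)%MS -> u *m frame_mx v = c *: u.
Proof.
move=> vN UT N1.
have [b bE] := commutant_right_mul (fun g Gg => esym (frame_mx_comm v Gg)) UT.
have nd0 : (n * d)%:R != 0 :> R.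
  rewrite pnatr_eq0 -lt0n muln_gt0 (leq_trans (mm_m_gt0 mm) (mm_m_le_n mm)) /=.
  by case: (mm_type mm).
suff b1 : b = real_scale c (1%:M : 'M[D]_m).
  move=> u /mm_isoP[A ->]; rewrite bE b1 real_scale_mulr mulmx1.
  exact: mm_isoZ.
apply: mip_inj => a; apply: (mulfI nd0).
have := frame_mx_trace a vN.
under eq_bigr do rewrite bE mm_iso_dotp.
rewrite mip_basis_mul -/(mip b a) mipC => ->.
rewrite /mip mulmxA N1 real_scale_mull mul1mx re_tr_scale re_tr_adj.
rewrite real_scale_mulr mulmx1 re_tr_scale re_tr_adj; ring.
Qed.

End MatrixModel.

(** * Assembling the isotypic components *)

Section DesignComponents.
Variables (R : realType) (gT : finGroupType) (G : {group gT}).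
Local Notation aG := (regular_repr R G).
Variables (V : 'M[R]_#|G|) (V_module : mxmodule aG V).
Variables (I : finType) (W : I -> 'M[R]_#|G|) (W_types : irr_types V W).
Local Notation Vi i := (isotypic_component V (W i)).
Variable mm : forall i : I, matrix_model (W i) (Vi i).

Lemma frame_mx_sub v m (A : 'M[R]_(m, #|G|)) :
  (v <= V)%MS -> (A *m frame_mx v <= V)%MS.
Proof.
move=> vV; rewrite /frame_mx -scalemxAr scalemx_sub // mulmx_sumr.
by apply: summx_sub => g Gg; rewrite mulmxA mulmx_sub // gact_module.
Qed.

Lemma frame_mx_proj v c : (v <= V)%MS ->
  frame_mx v = c *: oprojmx V <->
  (forall i (N : mm_mat (mm i)), v *m oprojmx (Vi i) = mm_iso N ->
     adjmx N *m N
       = real_scale (c * (mm_n (mm i) * fs_dim (mm_type (mm i)))%:R) 1%:M).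
Proof.
move=> vV; split=> [TE i N vN|Ngram].
  apply: (frame_mx_gram vN) => u uVi; rewrite TE -scalemxAr oprojmx_id //.
  exact: submx_trans uVi (isotypic_sub _ _ _).
have Tc i (u : 'rV[R]_#|G|) : (u <= Vi i)%MS -> u *m frame_mx v = c *: u.
  have [N vN] := mm_isoP (mm i) (oprojmx_sub v (Vi i)).
  apply: (frame_mx_scalar vN); last exact: Ngram.
  apply: commuting_isotypic => //; last exact: frame_mx_sub.
  by move=> g Gg; rewrite frame_mx_comm.
apply: dotp_mx_inj => u w; rewrite -(scalemxAr c u (oprojmx V)) dotpZl.
(* T is symmetric with range in V, hence it vanishes on the complement of V and factors through the
   projection. *)
have -> : dotp (u *m frame_mx v) w = dotp (u *m oprojmx V *m frame_mx v) w.
  rewrite ![dotp (_ *m frame_mx v) w]dotp_mulmx frame_mx_sym.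
  by rewrite [RHS]dotp_mulmx oprojmx_sym oprojmx_id // frame_mx_sub.
rewrite [u *m oprojmx V](isotypic_decomp V_module W_types) ?oprojmx_sub //.
rewrite mulmx_suml dotpC dotp_sumr (dotpC (\sum_i _)) dotp_sumr mulr_sumr.
by apply: eq_bigr => i _; rewrite (Tc i) ?oprojmx_sub // dotpZr.
Qed.

Lemma isotypic_proj_sum (N : forall i, mm_mat (mm i)) j :
  (\sum_i mm_iso (N i)) *m oprojmx (Vi j) = mm_iso (N j).
Proof.
rewrite mulmx_suml (bigD1 j) //= oprojmx_id ?mm_iso_sub //.
rewrite big1 ?addr0 // => i ij.
by rewrite (oprojmx_isotypic W_types (i := i)) ?mm_iso_sub // (negPf ij).
Qed.

Lemma mm_size_gt0 i :
  [/\ (0 < mm_n (mm i))%N, (0 < mm_m (mm i))%N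
    & (0 < fs_dim (mm_type (mm i)))%N].
Proof.
have m0 := mm_m_gt0 (mm i); split=> //.
  exact: leq_trans m0 (mm_m_le_n (mm i)).
by case: (mm_type (mm i)).
Qed.

(** The Gram condition gives the i-th component the squared norm m n d / dim V = dim V_i / dim V,
    and the dimensions of the components add up to dim V. *)
Lemma unit_sphere_sum (N : forall i, mm_mat (mm i)) : V != 0 ->
  (forall i, adjmx (N i) *m N i = real_scale ((\rank V)%:R^-1
      * (mm_n (mm i) * fs_dim (mm_type (mm i)))%:R) 1%:M) ->
  unit_sphere V (\sum_i mm_iso (N i)).
Proof.
move=> V0 Ngram; split.
  apply: summx_sub => i _.
  exact: submx_trans (mm_iso_sub _) (isotypic_sub _ _ _).
have E i : dotp (\sum_j mm_iso (N j)) (mm_iso (N i))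
    = (\rank V)%:R^-1 * (\rank (Vi i))%:R.
  rewrite -(oprojmx_id (mm_iso_sub (N i))) -[oprojmx _]oprojmx_sym -dotp_mulmx.
  rewrite isotypic_proj_sum mm_iso_dotp /mip Ngram re_tr_scale re_tr1.
  by rewrite (mm_rank (mm i)) mulnAC [in RHS]natrM mulrA.
rewrite dotp_sumr; under eq_bigr do rewrite E.
rewrite -mulr_sumr -natr_sum -(rank_isotypic_sum V_module W_types) mulVf //.
by rewrite pnatr_eq0 mxrank_eq0.
Qed.

End DesignComponents.

(** * Design orbits as orbits of scaled isometries *)

Theorem theorem1p1 (R : realType) (gT : finGroupType) (G : {group gT})
    (V : 'M[R]_#|G|)
    (V_module : mxmodule (regular_repr R G) V)
    (V_neq0 : V != 0)
    (V_sub : (V <= regular0 R G)%MS)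
    (mu : probability (borel_rV R #|G|) R)
    (mu_sphere : sphere_measure V mu)
    (I : finType) (W : I -> 'M[R]_#|G|)
    (W_types : irr_types V W)
    (mm : forall i : I, matrix_model (W i) (isotypic_component V (W i))) :
  (forall v : 'rV[R]_#|G|, unit_sphere V v ->
     (spherical_design V mu 2 (gorbit v) <->
      exists M : forall i : I, mm_mat (mm i),
        (forall i : I,
           adjmx (M i) *m M i
             = real_scale ((mm_m (mm i))%:R^-1) 1%:M /\
           oproj (isotypic_component V (W i)) v
             = mm_iso (real_scale
                 (Num.sqrt ((\rank (isotypic_component V (W i)))%:R
                            / (\rank V)%:R))
                 (M i))) /\
        v = \sum_i mm_iso (real_scale
              (Num.sqrt ((\rank (isotypic_component V (W i)))%:R
                         / (\rank V)%:R))
              (M i)))) /\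
  (forall X : {fset 'rV[R]_#|G|},
     (exists2 v, unit_sphere V v & X = gorbit v /\ spherical_design V mu 2 X) <->
     (exists2 U : forall i : I, mm_sqmat (mm i),
        forall i : I, O_D (U i)
      & X = gorbit (\sum_i mm_iso (real_scale
              (Num.sqrt ((mm_n (mm i) * fs_dim (mm_type (mm i)))%:R
                         / (\rank V)%:R))
              (first_cols (mm_m_le_n (mm i)) (U i)))))).
Proof.
pose c : R := (\rank V)%:R^-1.
pose nd i : nat := (mm_n (mm i) * fs_dim (mm_type (mm i)))%N.
have c_gt0 : 0 < c by rewrite invr_gt0 ltr0n lt0n mxrank_eq0.
have nd_gt0 i : 0 < (nd i)%:R :> R.
  by have [n0 _ d0] := mm_size_gt0 mm i; rewrite ltr0n muln_gt0 n0 d0.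
have m_gt0 i : 0 < (mm_m (mm i))%:R :> R by rewrite ltr0n mm_m_gt0.
have rankE i : (\rank (isotypic_component V (W i)))%:R
    = (mm_m (mm i))%:R * (nd i)%:R :> R.
  by rewrite (mm_rank (mm i)) mulnAC mulnC natrM.
(* A design component has Gram matrix n d c. Dividing the component by [s i], whose square is m n d
   c, leaves 1 / m; dividing it by [r i] leaves 1. These are the two normalizations of the
   statement. *)
pose r i : R := Num.sqrt ((nd i)%:R * c).
pose s i : R := Num.sqrt ((\rank (isotypic_component V (W i)))%:R * c).
have r_gt0 i : 0 < r i by rewrite sqrtr_gt0 mulr_gt0.
have s_gt0 i : 0 < s i by rewrite sqrtr_gt0 rankE !mulr_gt0.
have r2 i : r i ^+ 2 = (nd i)%:R * c by rewrite sqr_sqrtr // mulr_ge0 ?ltW.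
have s2 i : s i ^+ 2 = (mm_m (mm i))%:R * (nd i)%:R * c.
  by rewrite -rankE sqr_sqrtr // rankE !mulr_ge0 ?ltW.
have design_iff v : unit_sphere V v -> spherical_design V mu 2 (gorbit v) <->
    (forall i (N : mm_mat (mm i)),
       v *m oprojmx (isotypic_component V (W i)) = mm_iso N ->
       adjmx N *m N = real_scale (c * (nd i)%:R) 1%:M).
  move=> Sv; rewrite spherical_design_frame //.
  by apply: frame_mx_proj; last by case: Sv.
have gram_scale i x y (A : mm_mat (mm i)) :
    adjmx A *m A = real_scale x 1%:M ->
    adjmx (real_scale y A) *m real_scale y A = real_scale (y ^+ 2 * x) 1%:M.
  move=> A1; rewrite adjmx_scale real_scale_mull real_scale_mulr A1.
  by rewrite !real_scaleA -expr2.
(* Both halves of the statement are rescalings of one correspondence, between design vectors and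
   families N with N^* N = c n d 1; this is its first direction. *)
have design_coord v : unit_sphere V v -> spherical_design V mu 2 (gorbit v) ->
    exists2 N : forall i, mm_mat (mm i),
      v = \sum_i mm_iso (N i)
      & forall i, adjmx (N i) *m N i = real_scale (c * (nd i)%:R) 1%:M.
  move=> Sv /(design_iff _ Sv) gramN.
  pose N i := sval (cid (mm_isoP (mm i) (oprojmx_sub v _))).
  have NE i : v *m oprojmx _ = mm_iso (N i) := svalP (cid (mm_isoP (mm i) _)).
  exists N => [|i]; last exact/gramN/NE.
  rewrite {1}(isotypic_decomp V_module W_types (proj1 Sv)).
  by apply: eq_bigr => i _; exact: NE.
have coord_design (N : forall i, mm_mat (mm i)) :
    (forall i, adjmx (N i) *m N i = real_scale (c * (nd i)%:R) 1%:M) ->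
    unit_sphere V (\sum_i mm_iso (N i)) /\
    spherical_design V mu 2 (gorbit (\sum_i mm_iso (N i))).
  move=> gramN; have Sv := unit_sphere_sum V_module W_types V_neq0 gramN.
  split=> //; apply/(design_iff _ Sv) => i A.
  by rewrite isotypic_proj_sum // => /mm_iso_inj <-.
split=> [v Sv|X]; split.
- move=> /(design_coord _ Sv)[N vE gramN].
  exists (fun i => real_scale (s i)^-1 (N i)).
  have sN i : real_scale (s i) (real_scale (s i)^-1 (N i)) = N i.
    by rewrite real_scaleA divff ?gt_eqF // real_scale1.
  split=> [i|]; last by rewrite {1}vE; apply: eq_bigr => i _; rewrite sN.
  split; last by rewrite sN oprojE vE isotypic_proj_sum.
  rewrite (gram_scale _ _ _ _ (gramN i)) exprVn s2; congr real_scale.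
  by field; rewrite !gt_eqF.
- move=> [M [ME vE]]; rewrite vE; refine (proj2 (coord_design _ _)) => i.
  rewrite (gram_scale _ _ _ _ (proj1 (ME i))) s2; congr real_scale.
  by field; rewrite !gt_eqF.
- move=> [v Sv [-> /(design_coord _ Sv)[N vE gramN]]].
  (* The quotient of [N i] by [r i] has orthonormal columns, so it consists of the first columns of
     some element of O_D(n). *)
  have U_ex i : exists U : mm_sqmat (mm i), O_D U /\
      real_scale (r i) (first_cols (mm_m_le_n (mm i)) U) = N i.
    have [|U U1 UE] := @isometry_extend _ _ _ _ (mm_m_le_n (mm i))
      (real_scale (r i)^-1 (N i)).
      rewrite (gram_scale _ _ _ _ (gramN i)) exprVn r2 -[RHS]real_scale1.
      by congr real_scale; field; rewrite !gt_eqF.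
    exists U; split=> //.
    by rewrite UE real_scaleA divff ?gt_eqF // real_scale1.
  exists (fun i => sval (cid (U_ex i))) => [i|].
    by case: (svalP (cid (U_ex i))).
  congr gorbit; rewrite vE; apply: eq_bigr => i _.
  by case: (svalP (cid (U_ex i))) => _ ->.
- move=> [U U1 ->].
  have [i|Sv dv] := coord_design
    (fun i => real_scale (r i) (first_cols (mm_m_le_n (mm i)) (U i))).
    have U1' : adjmx (first_cols (mm_m_le_n (mm i)) (U i))
        *m first_cols (mm_m_le_n (mm i)) (U i) = real_scale 1 1%:M.
      by rewrite adjmx_first_cols // real_scale1.
    by rewrite (gram_scale _ _ _ _ U1') r2 mulr1 mulrC.
  by eexists; [exact: Sv | split].
Qed.
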